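(* Let $p\ge 2$ and $p'=\frac{p}{p-1}$. There exist positive constants $\alpha=\alpha(p)$, $\gamma=\gamma(p)$ depending only on $p$, and $\beta=\beta(p,C_\Omega,T,f)$ depending only on $p$, $C_\Omega$, $T$ and $f$ (in particular all three independent of $\varepsilon$ and of the discretisation), such that for every $\varepsilon>0$, if $u^\varepsilon\in\mathcal{K}(0,0)$ satisfies $$A(u^\varepsilon,v)+B(u^\varepsilon;v)=f(v)\quad\text{for all }v\in\mathcal{K}(0,0),$$ and $u^\varepsilon_{\tau,h}\in\mathcal{K}_{\tau,h}$ satisfies $$A(u^\varepsilon_{\tau,h},v)+B(u^\varepsilon_{\tau,h};v)=f(v)\quad\text{for all }v\in\mathcal{K}_{\tau,h},$$ then $e_\varepsilon:=u^\varepsilon-u^\varepsilon_{\tau,h}$ satisfies $$\|e_\varepsilon\|_{E_\varepsilon}^2+\alpha\|e_\varepsilon\|_{L^p_\varepsilon(L^p)}^p\le\inf_{v\in\mathcal{K}_{\tau,h}}\Big(\|u^\varepsilon-v\|_{E_\varepsilon}^2+\beta\|u^\varepsilon-v\|_{L^p_\varepsilon(L^p)}^{p'}+\gamma\|u^\varepsilon-v\|_{L^p_\varepsilon(L^p)}^p\Big).$$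
   Context: $\Omega\subset\mathbb{R}^d$, $d\in\{1,2,3\}$, is a bounded polygonal/polyhedral domain (an interval if $d=1$), $T>0$ finite, $I=(0,T]$, $D=\Omega\times I$, $f\in L^2(0,T;L^2(\Omega))$; $C_\Omega$ is the Poincaré constant of $\Omega$ (for $H^1_0(\Omega)$). Spaces: $\mathcal{U}=H^2(I;L^2(\Omega))\cap L^2(I;H^1_0(\Omega))\cap L^p(D)$, $\mathcal{K}(0,0)=\{u\in\mathcal{U}:u(0)=0,\ u_t(0)=0\}$. Forms: $A(u,v)=\int_0^Te^{-t/\varepsilon}\big(\varepsilon^2\langle u_{tt},v_{tt}\rangle_{L^2(\Omega)}+\langle\nabla u,\nabla v\rangle_{L^2(\Omega)}\big)\,\mathrm{d}t$, $B(u;v)=\frac p2\int_0^Te^{-t/\varepsilon}\langle|u|^{p-2}u,v\rangle_{L^2(\Omega)}\,\mathrm{d}t$, $f(v)=\int_0^Te^{-t/\varepsilon}\langle f,v\rangle_{L^2(\Omega)}\,\mathrm{d}t$. Norms: $\|g\|_{E_\varepsilon}=\sqrt{A(g,g)}=\big(\int_0^Te^{-t/\varepsilon}(\varepsilon^2\|g_{tt}\|_{L^2(\Omega)}^2+\|\nabla g\|_{L^2(\Omega)}^2)\,\mathrm{d}t\big)^{1/2}$ and $\|g\|_{L^p_\varepsilon(L^p)}=\big(\int_0^Te^{-t/\varepsilon}\|g\|_{L^p(\Omega)}^p\,\mathrm{d}t\big)^{1/p}$. Discrete space: $0=t_0<t_1<\dots<t_{N_t}=T$, $I_i=(t_i,t_{i+1}]$;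 for $r\in\mathbb{N}$, $r\ge1$, $\mathcal{S}^{\Delta_\tau}(r+2)=\{\phi\in C^2([0,T]):\phi|_{I_j}\in\mathcal{P}_{r+2}(I_j),\ j=0,\dots,N_t-1\}$ and $U_\tau=\{\phi\in\mathcal{S}^{\Delta_\tau}(r+2):\phi(0)=0,\ \phi_t(0)=0\}$. $\mathcal{T}_h$ is a shape-regular mesh of $\Omega$ and $V_h=\{v\in H^1_0(\Omega): v|_K\in\mathcal{P}_s(K)\text{ for all }K\in\mathcal{T}_h\}$, $s\ge1$. Finally $\mathcal{K}_{\tau,h}=U_\tau\otimes V_h\subset\mathcal{K}(0,0)$. *)

(* Defs.v *)
From HB Require Import structures.
From mathcomp Require Import all_boot all_order all_algebra.
From mathcomp Require Import all_classical all_reals all_analysis.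

Set Implicit Arguments.
Unset Strict Implicit.
Unset Printing Implicit Defensive.

Import Order.TTheory GRing.Theory Num.Theory.
Import numFieldNormedType.Exports.

Local Open Scope classical_set_scope.
Local Open Scope ring_scope.

Section measurable_rV.
Variables (R : realType) (n : nat).

Let coors : 'I_n -> 'rV[R]_n -> R := fun i x => x ord0 i.

Let rV_set0 : g_sigma_preimage coors set0.
Proof. exact: sigma_algebra0. Qed.

Let rV_setC A : g_sigma_preimage coors A -> g_sigma_preimage coors (~` A).
Proof. exact: sigma_algebraC. Qed.

Let rV_bigcup (F : (set 'rV[R]_n)^nat) :
  (forall i, g_sigma_preimage coors (F i)) ->
  g_sigma_preimage coors (\bigcup_i (F i)).
Proof. exact: sigma_algebra_bigcup. Qed.

HB.instance Definition _ := @isMeasurable.Build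
  (measure_tuple_display (default_measure_display)) 'rV[R]_n
  (g_sigma_preimage coors) rV_set0 rV_setC rV_bigcup.

End measurable_rV.

Section lebesgue_rV.
Variable R : realType.

Lemma measurable_fun_rVP d (T : measurableType d) n (f : T -> 'rV[R]_n) :
  measurable_fun [set: T] f <->
  forall i, measurable_fun [set: T] (fun x => f x ord0 i).
Proof.
pose c (i : 'I_n) (x : 'rV[R]_n) := x ord0 i.
apply: (@iff_trans _ (g_sigma_preimage (fun i => c i \o f) `<=` measurable)).
  rewrite g_sigma_preimage_comp; split=> [mf A [/= C preC <-]|prefS].
    exact: mf.
  by move=> _ A mA; apply: prefS; exists A.
split=> [fS i|mf].
- move=> _ A mA.
  apply: fS; apply: sub_sigma_algebra; rewrite -bigcup_seq/=.
  by exists i => /=; [rewrite mem_index_enum|exists A].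
- apply: smallest_sub; first exact: sigma_algebra_measurable.
  rewrite -bigcup_seq/=; apply: bigcup_sub => i _.
  by move=> A [B mB <-]; exact: mf.
Qed.

Lemma measurable_rV_coord n (i : 'I_n) :
  measurable_fun [set: 'rV[R]_n] (fun x => x ord0 i).
Proof. by move/measurable_fun_rVP: (@measurable_id _ _ [set: 'rV[R]_n]); apply. Qed.

Definition consr n (p : measurableTypeR R * 'rV[R]_n) : 'rV[R]_n.+1 :=
  \row_i (if unlift ord0 i is Some j then p.2 ord0 j else p.1).

Definition unconsr n (x : 'rV[R]_n.+1) : measurableTypeR R * 'rV[R]_n :=
  (x ord0 ord0, \row_j x ord0 (lift ord0 j)).

Lemma consrK n : cancel (@consr n) (@unconsr n).
Proof.
move=> [a y]; rewrite /unconsr /consr mxE unlift_none; congr pair.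
by apply/rowP => j; rewrite !mxE liftK.
Qed.

Lemma measurable_consr n : measurable_fun [set: measurableTypeR R * 'rV[R]_n] (@consr n).
Proof.
apply/measurable_fun_rVP => i; under eq_fun do rewrite mxE.
case: (unlift ord0 i) => [j|]; last exact: measurable_fst.
by apply: (measurableT_comp (@measurable_rV_coord n j)); exact: measurable_snd.
Qed.

Lemma measurable_unconsr n : measurable_fun [set: 'rV[R]_n.+1] (@unconsr n).
Proof.
apply/measurable_fun_pair; first exact: measurable_rV_coord.
apply/measurable_fun_rVP => j; under eq_fun do rewrite mxE.
exact: measurable_rV_coord.
Qed.

Lemma unconsrK n : cancel (@unconsr n) (@consr n).
Proof.
move=> x; apply/rowP => i; rewrite mxE.
by case: unliftP => [j ->|->]; rewrite ?mxE.
Qed.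

Section lebesgue_rVS.
Variables (n : nat) (m : {sigma_finite_measure set 'rV[R]_n -> \bar R}).

Definition lebesgue_rVS : set 'rV[R]_n.+1 -> \bar R :=
  pushforward (@lebesgue_measure R \x m)%E (@consr n).

Let lebesgue_rVS0 : lebesgue_rVS set0 = 0%E.
Proof. by rewrite /lebesgue_rVS /pushforward preimage_set0 measure0. Qed.

Let lebesgue_rVS_ge0 A : (0 <= lebesgue_rVS A)%E.
Proof. by rewrite /lebesgue_rVS /pushforward; exact: measure_ge0. Qed.

Let lebesgue_rVS_semi_sigma_additive : semi_sigma_additive lebesgue_rVS.
Proof.
move=> F mF tF mUF; rewrite /lebesgue_rVS /pushforward preimage_bigcup.
apply: measure_semi_sigma_additive.
- by move=> k; rewrite -[X in measurable X]setTI; exact: measurable_consr.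
- apply/trivIsetP => /= i j _ _ ij; rewrite -preimage_setI.
  by move/trivIsetP : tF => /(_ _ _ _ _ ij) ->//; rewrite preimage_set0.
- rewrite -preimage_bigcup -[X in measurable X]setTI.
  exact: measurable_consr.
Qed.

HB.instance Definition _ := isMeasure.Build _ _ _ lebesgue_rVS
  lebesgue_rVS0 lebesgue_rVS_ge0 lebesgue_rVS_semi_sigma_additive.

Let lebesgue_rVS_sigma_finite : sigma_finite setT lebesgue_rVS.
Proof.
have /sigma_finiteP[F [TF ndF Foo]] := sigma_finiteT (@lebesgue_measure R).
have /sigma_finiteP[G [TG ndG Goo]] := sigma_finiteT m.
exists (fun k => @unconsr n @^-1` (F k `*` G k)).
  rewrite -preimage_bigcup predeqE => x; split=> // _.
  have [i _ Fi] : (\bigcup_i F i) (unconsr x).1 by rewrite -TF.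
  have [j _ Gj] : (\bigcup_i G i) (unconsr x).2 by rewrite -TG.
  exists (maxn i j) => //; split.
  - by move: Fi; exact/subsetPset/ndF/leq_maxl.
  - by move: Gj; exact/subsetPset/ndG/leq_maxr.
move=> k; have [mF Fk] := Foo k; have [mG Gk] := Goo k; split.
  rewrite -[X in measurable X]setTI; apply: measurable_unconsr => //.
  exact: measurableX.
rewrite /lebesgue_rVS /pushforward.
have -> : @consr n @^-1` (@unconsr n @^-1` (F k `*` G k)) = F k `*` G k.
  by rewrite /preimage predeqE => y; rewrite /mkset consrK.
by rewrite product_measure1E// lte_mul_pinfty// ge0_fin_numE.
Qed.

HB.instance Definition _ := Measure_isSigmaFinite.Build _ _ _ lebesgue_rVS
  lebesgue_rVS_sigma_finite.

End lebesgue_rVS.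

Fixpoint lebesgue_rV n : {sigma_finite_measure set 'rV[R]_n -> \bar R} :=
  if n is n'.+1 then lebesgue_rVS (lebesgue_rV n')
  else @dirac _ 'rV[R]_0 0 R.

End lebesgue_rV.

Section geometry.
Variables (R : realType) (d : nat).
Implicit Types (x y : 'rV[R]_d) (Omega K : set 'rV[R]_d).

(* The norm [`|x|] of the library on ['rV[R]_d] is the maximum norm. *)
Definition dotv x y : R := \sum_(i < d) x ord0 i * y ord0 i.
Definition norm2 x : R := Num.sqrt (dotv x x).

Definition convex_hull (k : nat) (P : 'I_k -> 'rV[R]_d) : set 'rV[R]_d :=
  [set x | exists c : 'I_k -> R,
    [/\ forall i, 0 <= c i, \sum_i c i = 1 & x = \sum_i c i *: P i]].

(* Simplices, but also convex quadrilaterals, hexahedra, etc. *)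
Definition polytope K : Prop :=
  (exists (k : nat) (P : 'I_k -> 'rV[R]_d), K = convex_hull P) /\
  K° !=set0.

(* For [d = 1] this says that [Omega] is a bounded open interval. Nonconvex and
   non-Lipschitz polyhedra are allowed, slits are not. *)
Definition polyhedral_domain Omega : Prop :=
  [/\ Omega !=set0, connected Omega &
      exists (k : nat) (P : 'I_k -> set 'rV[R]_d),
        (forall j, polytope (P j)) /\ Omega = (\bigcup_j P j)°].

Definition is_mesh Omega (m : nat) (K : 'I_m -> set 'rV[R]_d) : Prop :=
  [/\ forall j, polytope (K j),
      \bigcup_j K j = closure Omega &
      forall i j, i != j -> (K i)° `&` (K j)° = set0].

(* Every cell contains a Euclidean ball of radius comparable to its diameter,
   with the ratio controlled by [sigma]. *)
Definition shape_regular (sigma : R) (m : nat) (K : 'I_m -> set 'rV[R]_d) :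
  Prop :=
  forall j, exists (c : 'rV[R]_d) (rho : R),
    [/\ 0 < rho, [set x | norm2 (x - c) <= rho] `<=` K j &
        forall x y, K j x -> K j y -> norm2 (x - y) <= sigma * rho].

Definition poly_fun (s : nat) (q : 'rV[R]_d -> R) : Prop :=
  exists c : {ffun 'I_d -> 'I_s.+1} -> R, forall x,
    q x = \sum_(a : {ffun 'I_d -> 'I_s.+1} | (\sum_i a i <= s)%N)
            c a * \prod_i x ord0 i ^+ a i.

End geometry.

(* Used for [V = R] and [V = 'rV[R]_d]. In finite dimension, existence and
   continuity of all iterated directional derivatives is C^oo. *)
Section test_functions.
Variables (R : realType) (V : normedModType R).

Definition iter_derive (vs : seq V) (f : V -> R) : V -> R :=
  foldr (fun v g => 'D_v g) f vs.

Definition smooth (f : V -> R) : Prop :=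
  forall vs : seq V, continuous (iter_derive vs f) /\
    forall x v : V, derivable (iter_derive vs f) x v.

Definition Cc_infty (U : set V) (f : V -> R) : Prop :=
  [/\ smooth f, compact (closure [set x | f x != 0]) &
      closure [set x | f x != 0] `<=` U].

End test_functions.

Definition in_Lp d (X : measurableType d) (R : realType)
    (mu : {measure set X -> \bar R}) (D : set X) (p : R) (f : X -> R) : Prop :=
  measurable_fun D f /\ (\int[mu]_(x in D) (`|f x| `^ p)%:E < +oo)%E.

Section space.
Variables (R : realType) (d : nat) (Omega : set 'rV[R]_d).
Local Notation E := 'rV[R]_d.
Implicit Types (v w : E -> R) (G H : E -> E).

Definition ip v w : R := \int[lebesgue_rV R d]_(x in Omega) (v x * w x).
Definition ipv G H : R := \int[lebesgue_rV R d]_(x in Omega) dotv (G x) (H x).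
Definition normL2 v : R := Num.sqrt (ip v v).
Definition normL2v G : R := Num.sqrt (ipv G G).
Definition normLp (p : R) v : R :=
  (\int[lebesgue_rV R d]_(x in Omega) (`|v x| `^ p)) `^ (p^-1).

Definition L2 v : Prop := in_Lp (lebesgue_rV R d) Omega 2 v.

Definition gradient v : E -> E := fun x => \row_i 'D_(delta_mx ord0 i) v x.

Definition weak_gradient v G : Prop :=
  forall (i : 'I_d) (psi : E -> R), Cc_infty Omega psi ->
    ip v (fun x => gradient psi x ord0 i) = - ip (fun x => G x ord0 i) psi.

(* Weakly differentiable functions are represented together with their weak
   gradient, which is unique up to a null set. *)
Definition H1 v G : Prop :=
  [/\ L2 v, forall i : 'I_d, L2 (fun x => G x ord0 i) & weak_gradient v G].

(* [H^1_0] is the closure of [Cc_infty Omega] in [H1]. *)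
Definition H10 v G : Prop :=
  H1 v G /\ forall e : R, 0 < e -> exists2 psi : E -> R, Cc_infty Omega psi &
    normL2 (v \- psi) + normL2v (fun x => G x - gradient psi x) < e.

Definition poincare_constant (C : R) : Prop :=
  0 < C /\ forall v G, H10 v G -> normL2 v <= C * normL2v G.

End space.

(* An element of [H^2(I; L^2(Omega))] with values in [H^1_0(Omega)], given by a
   representative and representatives of its weak time derivatives and weak
   spatial gradient, which are unique up to null sets. *)
Record stfun (R : realType) (d : nat) := STFun {
  st_val : R -> 'rV[R]_d -> R;
  st_dt : R -> 'rV[R]_d -> R;
  st_dtt : R -> 'rV[R]_d -> R;
  st_grad : R -> 'rV[R]_d -> 'rV[R]_d
}.

Definition st_sub (R : realType) (d : nat) (u v : stfun R d) : stfun R d :=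
  STFun (fun t x => st_val u t x - st_val v t x)
        (fun t x => st_dt u t x - st_dt v t x)
        (fun t x => st_dtt u t x - st_dtt v t x)
        (fun t x => st_grad u t x - st_grad v t x).

Section spacetime.
Variables (R : realType) (d : nat) (T : R) (Omega : set 'rV[R]_d).
Local Notation E := 'rV[R]_d.
Local Notation leb := (@lebesgue_measure R).
Local Notation lebx := (lebesgue_rV R d).
Implicit Types (u v : stfun R d) (g : R -> E -> R).

Definition timeI : set (measurableTypeR R) := `]0, T]%classic.
Definition cylinder : set (measurableTypeR R * E) := timeI `*` Omega.

(* [L^p(0,T; L^p(Omega))] is identified with [L^p] of the cylinder. *)
Definition in_Lp_D (p : R) g : Prop :=
  in_Lp (leb \x lebx)%E cylinder p (fun z => g z.1 z.2).

(* [h] is the weak time derivative of [g] : the integrals over [I] are those of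
   [L^2(Omega)]-valued functions, hence the almost everywhere equality. *)
Definition weak_dt g h : Prop :=
  forall psi : R -> R, Cc_infty `]0, T[%classic psi ->
    {ae lebx, forall x, Omega x ->
      \int[leb]_(t in timeI) (g t x * derive1 psi t) =
      - \int[leb]_(t in timeI) (h t x * psi t)}.

Definition H2_L2 u : Prop :=
  [/\ in_Lp_D 2 (st_val u), in_Lp_D 2 (st_dt u), in_Lp_D 2 (st_dtt u),
      weak_dt (st_val u) (st_dt u) & weak_dt (st_dt u) (st_dtt u)].

Definition L2_H10 u : Prop :=
  [/\ in_Lp_D 2 (st_val u),
      forall i : 'I_d, in_Lp_D 2 (fun t x => st_grad u t x ord0 i) &
      {ae leb, forall t, timeI t -> H10 Omega (st_val u t) (st_grad u t)}].

Definition spaceU (p : R) u : Prop :=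
  [/\ H2_L2 u, L2_H10 u & in_Lp_D p (st_val u)].

(* The representative of [g] in [C([0,T]; L^2(Omega))] vanishes at [t = 0]. *)
Definition zero_at0 g : Prop :=
  exists w : R -> E -> R,
    [/\ forall t, t \in `[0, T] -> L2 Omega (w t),
        forall s, s \in `[0, T] ->
          normL2 Omega (w t \- w s) @[t --> within `[0, T]%classic (nbhs s)]
            --> (0 : R),
        {ae leb, forall t, timeI t ->
          {ae lebx, forall x, Omega x -> w t x = g t x}} &
        {ae lebx, forall x, Omega x -> w 0 x = 0}].

Definition K00 (p : R) u : Prop :=
  [/\ spaceU p u, zero_at0 (st_val u) & zero_at0 (st_dt u)].

Section forms.
Variable eps : R.

Definition wint (h : R -> R) : R :=
  \int[leb]_(t in timeI) (expR (- t / eps) * h t).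

Definition bilinA u v : R :=
  wint (fun t => eps ^+ 2 * ip Omega (st_dtt u t) (st_dtt v t)
                 + ipv Omega (st_grad u t) (st_grad v t)).

Definition semilinB (p : R) u v : R :=
  p / 2 * wint (fun t =>
    ip Omega (fun x => `|st_val u t x| `^ (p - 2) * st_val u t x) (st_val v t)).

Definition loadF (f : R -> E -> R) v : R :=
  wint (fun t => ip Omega (f t) (st_val v t)).

Definition normE u : R := Num.sqrt (bilinA u u).

Definition normLpeps (p : R) u : R :=
  (wint (fun t => normLp Omega p (st_val u t) `^ p)) `^ (p^-1).

End forms.

End spacetime.

Section discrete.
Variables (R : realType) (d : nat) (T : R) (Omega : set 'rV[R]_d).
Local Notation E := 'rV[R]_d.

Definition time_partition (N : nat) (tau : nat -> R) : Prop :=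
  [/\ tau 0%N = 0, tau N = T & forall j, (j < N)%N -> tau j < tau j.+1].

(* [phi] is in [C^2([0,T])] with derivatives [phi1] and [phi2]. *)
Definition C2 (phi phi1 phi2 : R -> R) : Prop :=
  [/\ {within `[0, T]%classic, continuous phi},
      {within `[0, T]%classic, continuous phi1},
      {within `[0, T]%classic, continuous phi2} &
      forall t, t \in `]0, T[ ->
        is_derive t 1 phi (phi1 t) /\ is_derive t 1 phi1 (phi2 t)].

Definition spline (r N : nat) (tau : nat -> R) (phi phi1 phi2 : R -> R) :
  Prop :=
  C2 phi phi1 phi2 /\
  forall j, (j < N)%N -> exists2 q : {poly R}, (size q <= (r + 2).+1)%N &
    forall t, t \in `]tau j, tau j.+1] -> phi t = q.[t].

Definition U_tau (r N : nat) (tau : nat -> R) (phi phi1 phi2 : R -> R) : Prop :=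
  [/\ spline r N tau phi phi1 phi2, phi 0 = 0 & phi1 0 = 0].

Definition V_h (s m : nat) (K : 'I_m -> set E) (v : E -> R) (G : E -> E) :
  Prop :=
  H10 Omega v G /\
  forall j, exists2 q, poly_fun s q &
    {ae lebesgue_rV R d, forall x, (K j `&` Omega) x -> v x = q x}.

(* Finite sums of elementary tensors, with the induced derivatives. *)
Definition K_tau_h (r N : nat) (tau : nat -> R)
    (s m : nat) (K : 'I_m -> set E) (w : stfun R d) : Prop :=
  exists (k : nat) (phi phi1 phi2 : 'I_k -> R -> R)
         (v : 'I_k -> E -> R) (G : 'I_k -> E -> E),
    [/\ forall i, U_tau r N tau (phi i) (phi1 i) (phi2 i),
        forall i, V_h s K (v i) (G i) &
        forall t x, timeI T t -> Omega x ->
          [/\ st_val w t x = \sum_i phi i t * v i x,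
              st_dt w t x = \sum_i phi1 i t * v i x,
              st_dtt w t x = \sum_i phi2 i t * v i x &
              st_grad w t x = \sum_i phi i t *: G i x]].

End discrete.

(* Main.v *)
Require Import Defs.
From mathcomp Require Import all_boot all_order all_algebra.
From mathcomp Require Import all_classical all_reals all_analysis.
From mathcomp Require Import measurable_realfun.
From mathcomp Require Import ring lra.

Set Implicit Arguments.
Unset Strict Implicit.
Unset Printing Implicit Defensive.

Import Order.TTheory GRing.Theory Num.Theory.
Import numFieldNormedType.Exports.

Local Open Scope classical_set_scope.
Local Open Scope ring_scope.

(** The estimate is a quasi-optimality argument for a strongly monotone problem.

    Write [e = u - uh] and, for a discrete [v], [g = u - v]. All the forms are
    integrals over the space-time cylinder against the weight [e^(-t/eps)]; this
    is Fubini's theorem ([wint_fubini]). The discrete space consists of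
    admissible functions ([K_tau_h_sub_K00]), so both weak equations can be
    tested with [uh] and with [v], and the residual of the error, tested with
    [e - g = v - uh], vanishes. Therefore

      A(e,e) + B(u;e) - B(uh;e) = A(e,g) + B(u;g) - B(uh;g).

    On the left, the signed power [|x|^(p-2) x] is strongly monotone with
    constant [c = 2^(1-p)] ([spow_mono]). On the right, the quadratic part is
    split by Young's inequality, and the Lipschitz bound of the signed power
    followed by a three-factor Young inequality gives, for every [s > 0],

      (c/2) |e|^p + (p-1) s (|u|^p + |uh|^p) + K s^(-(p-2)) |g|^p

    as a pointwise bound of the nonlinear part ([spow_perturb]). The first term
    is absorbed on the left. The integral of [|u|^p + |uh|^p] is bounded by a
    multiple of [C^2] times the squared norm of [f], uniformly in [eps] and in
    the discretisation: this is the energy estimate [apriori_bound], in which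
    the Poincare inequality is used at almost every time. What remains is to
    choose [s]: with [S] the integral of the weighted [|g|^p], the choice
    [s = S^(1/(p-1))] turns both remaining terms into multiples of
    [S^(1/(p-1))], which is the [p/(p-1)]-th power of the norm of [g]
    ([balance]). This gives the estimate with [alpha = p c / 2] and [gamma = 1].

    Most of the work lies in the inclusion of the discrete space: splines are
    differentiated weakly by integration by parts, the discrete functions in
    space are bounded because they are piecewise polynomial on a bounded
    domain, hence in every Lebesgue space with exponent at least [2], and the
    functions of [H10] must be shown to form a vector space. *)

(** * The signed power and its inequalities *)

Section signed_power.
Variables (R : realType) (p : R).
Hypothesis p_ge2 : 2 <= p.
Implicit Types a b e w x y z : R.

Definition spow (x : R) : R := `|x| `^ (p - 2) * x.

Let p2_ge0 : 0 <= p - 2. Proof. by rewrite subr_ge0. Qed.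
Let p_gt0 : 0 < p. Proof. exact: lt_le_trans p_ge2. Qed.

Lemma le_powR r x y : 0 <= r -> 0 <= x -> x <= y -> x `^ r <= y `^ r.
Proof.
by move=> r0 x0 xy; apply: ge0_ler_powR => //; rewrite nnegrE// (le_trans x0).
Qed.

Lemma spowN x : spow (- x) = - spow x.
Proof. by rewrite /spow normrN mulrN. Qed.

Lemma spow_ge0 x : 0 <= x -> spow x = x `^ (p - 1).
Proof.
have hp := p_ge2.
move=> x0; rewrite /spow ger0_norm//.
have [->|xn0] := eqVneq x 0.
  by rewrite mulr0 powR0// gt_eqF//; lra.
by rewrite -[X in _ * X](powRr1 x0) -powRD ?xn0 ?implybT//; congr (_ `^ _); lra.
Qed.

Lemma powR_pE x : 0 <= x -> x `^ p = x `^ (p - 2) * x ^+ 2.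
Proof.
have hp := p_ge2.
move=> x0; have [->|xn0] := eqVneq x 0.
  by rewrite expr0n/= mulr0 powR0// gt_eqF.
rewrite -[x ^+ 2]powR_mulrn// -powRD ?xn0 ?implybT//; congr (_ `^ _); lra.
Qed.

Lemma spowM x : spow x * x = `|x| `^ p.
Proof.
by rewrite powR_pE// real_normK ?num_real// /spow -mulrA -expr2.
Qed.

(** Bounding every factor by the largest of the three gives Young's inequality
    with all constants equal to [1]; sharper weights are recovered by scaling. *)
Lemma young3 x y z : 0 <= x -> 0 <= y -> 0 <= z ->
  x `^ (p - 2) * (y * z) <= x `^ p + y `^ p + z `^ p.
Proof.
have hp := p_ge2.
move=> x0 y0 z0; set m := Num.max x (Num.max y z).
have mx : x <= m by rewrite le_max lexx.
have my : y <= m by rewrite !le_max lexx orbT.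
have mz : z <= m by rewrite !le_max lexx !orbT.
have m0 : 0 <= m by exact: le_trans mx.
have /le_trans : x `^ (p - 2) * (y * z) <= m `^ p.
  rewrite powR_pE// expr2 ler_pM ?powR_ge0 ?mulr_ge0//; first exact: le_powR.
  exact: ler_pM.
apply.
have := powR_ge0 x p; have := powR_ge0 y p; have := powR_ge0 z p.
have : m = x \/ m = y \/ m = z.
  by rewrite /m /Num.max; case: ifP; case: ifP; auto.
by case=> [->|[->|->]]; lra.
Qed.

(** Rescaling [x] by [s^(1/p)] and [y] by [(del/L)^(1/p)] in [young3], and [z] so
    that the product is unchanged, makes the two weights [s] and [del] arbitrary. *)
Lemma young3_scaled L del s x y z : 0 < L -> 0 < del -> 0 < s ->
  0 <= x -> 0 <= y -> 0 <= z ->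
  L * (x `^ (p - 2) * (y * z)) <=
  del * y `^ p + L * s * x `^ p + L ^+ 2 / del * s `^ (- (p - 2)) * z `^ p.
Proof.
move=> L0 del0 s0 x0 y0 z0.
pose k := (del / L) `^ p^-1.
pose q := s `^ p^-1.
have dL0 : 0 < del / L by rewrite divr_gt0.
have k0 : 0 < k by rewrite powR_gt0.
have q0 : 0 < q by rewrite powR_gt0.
have pV : p^-1 * p = 1 by rewrite mulVf// gt_eqF.
have kp : k `^ p = del / L by rewrite /k -powRrM pV powRr1// ltW.
have qp : q `^ p = s by rewrite /q -powRrM pV powRr1// ltW.
pose c := (k * q `^ (p - 2))^-1.
have c0 : 0 < c by rewrite invr_gt0 mulr_gt0// powR_gt0.
have cp : c `^ p = L / del * s `^ (- (p - 2)).
  rewrite /c -powR_inv1; last by rewrite mulr_ge0 ?powR_ge0// ltW.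
  rewrite powRAC powRM ?powR_ge0 ?(ltW k0)// kp powRAC qp powRM ?powR_ge0 ?(ltW dL0)//.
  by rewrite powR_inv1 ?(ltW dL0)// invf_div -powRrM mulrN1.
have := @young3 (q * x) (k * y) (c * z).
rewrite !mulr_ge0 ?(ltW q0) ?(ltW k0) ?(ltW c0)// => /(_ isT isT isT).
rewrite !powRM ?(ltW q0) ?(ltW k0) ?(ltW c0)// kp qp cp.
have -> : q `^ (p - 2) * x `^ (p - 2) * (k * y * (c * z)) =
          (k * q `^ (p - 2)) * c * (x `^ (p - 2) * (y * z)) by ring.
rewrite /c divff ?mul1r; last by rewrite gt_eqF// mulr_gt0// powR_gt0.
move=> /(ler_wpM2l (ltW L0)) /le_trans; apply.
rewrite le_eqVlt; apply/orP; left; apply/eqP.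
by field; rewrite !gt_eqF.
Qed.

(** Superadditivity of [t^(p-1)] on the half line. *)
Lemma spow_mono0 a b : 0 <= b -> b <= a ->
  (a - b) `^ (p - 1) <= spow a - spow b.
Proof.
have hp := p_ge2.
move=> b0 ba; have a0 := le_trans b0 ba.
have ab0 : 0 <= a - b by rewrite subr_ge0.
rewrite -spow_ge0// /spow !ger0_norm//.
have h1 : (a - b) `^ (p - 2) * (a - b) <= a `^ (p - 2) * (a - b).
  by rewrite ler_wpM2r// le_powR// gerBl.
have h2 : b `^ (p - 2) * b <= a `^ (p - 2) * b by rewrite ler_wpM2r// le_powR.
lra.
Qed.

(** The tangent inequality of the convex function [t^(p-1)], read off from
    Young's inequality for the exponent [p-1] and its conjugate. *)
Lemma powRBl1 a b : 0 <= b -> b <= a ->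
  a `^ (p - 1) - b `^ (p - 1) <= (p - 1) * (a `^ (p - 2) * (a - b)).
Proof.
have hp := p_ge2.
move=> b0 ba; have a0 := le_trans b0 ba.
have [p2|pn2] := eqVneq p 2.
  have -> : p - 2 = 0 by lra.
  have -> : p - 1 = 1 by lra.
  by rewrite !powRr1// powRr0; lra.
have p2 : 2 < p by rewrite lt_neqAle eq_sym pn2.
have := @conjugate_powR R b (a `^ (p - 2)) (p - 1) ((p - 1) / (p - 2)) b0
  (powR_ge0 _ _).
have -> : (p - 1)^-1 + ((p - 1) / (p - 2))^-1 = 1.
  by field; apply/andP; split; rewrite gt_eqF//; lra.
rewrite divr_gt0; [|lra|lra].
have p10 : 0 < p - 1 by lra.
rewrite p10 => /(_ isT isT erefl).
rewrite -powRrM.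
have -> : (p - 2) * ((p - 1) / (p - 2)) = p - 1 by field; rewrite gt_eqF//; lra.
move=> /(ler_wpM2l (ltW p10)) h.
have aE : a `^ (p - 1) = a `^ (p - 2) * a.
  by rewrite -spow_ge0// /spow ger0_norm.
have h2 : (p - 1) * (b `^ (p - 1) / (p - 1) + a `^ (p - 1) / ((p - 1) / (p - 2)))
  = b `^ (p - 1) + (p - 2) * a `^ (p - 1).
  by field; apply/andP; split; rewrite gt_eqF//; lra.
rewrite h2 in h; rewrite aE in h *; lra.
Qed.

(** Arguments of the same sign are covered by superadditivity. For opposite
    signs the larger of [|a|] and [|b|] is at least [|a - b| / 2], whence the
    constant. *)
Lemma spow_mono a b :
  2 `^ (1 - p) * `|a - b| `^ p <= (spow a - spow b) * (a - b).
Proof.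
have hp := p_ge2.
wlog ba : a b / b <= a.
  move=> H; have [/H//|/ltW/H] := leP b a.
  by rewrite distrC; lra.
have ab0 : 0 <= a - b by rewrite subr_ge0.
rewrite (ger0_norm ab0).
have abE : (a - b) `^ p = (a - b) `^ (p - 1) * (a - b).
  by rewrite -spow_ge0// spowM ger0_norm.
rewrite abE mulrA ler_wpM2r//.
have p10 : 0 <= p - 1 by lra.
have c1 : 2 `^ (1 - p) <= 1 :> R.
  have -> : 1 - p = - (p - 1) by lra.
  rewrite powRN invf_le1 ?powR_gt0//.
  by rewrite -[leLHS](powRr0 2) ler_powR// ler1n.
have h0 : 2 `^ (1 - p) * (a - b) `^ (p - 1) <= (a - b) `^ (p - 1).
  by rewrite -[leRHS]mul1r ler_wpM2r// powR_ge0.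
have [b0|b0] := leP 0 b.
  by rewrite (le_trans h0)// spow_mono0.
have [a0|a0] := leP a 0.
  have := @spow_mono0 (- b) (- a); rewrite !spowN oppr_ge0 a0 lerN2 ba.
  move=> /(_ isT isT); rewrite opprK (addrC (- b)) (addrC (- spow b)) => h.
  by rewrite opprK in h; exact: le_trans h.
(* the half sum of a and |b| is at most the larger of the two *)
have Nb0 : 0 <= - b by lra.
have -> : spow a - spow b = a `^ (p - 1) + (- b) `^ (p - 1).
  by rewrite -spowN !spow_ge0// ltW.
have -> : 2 `^ (1 - p) * (a - b) `^ (p - 1) = ((a - b) / 2) `^ (p - 1).
  rewrite powRM// mulrC; congr (_ * _).
  by rewrite -powR_inv1// -powRrM; congr (_ `^ _); lra.
have := powR_ge0 a (p - 1); have := powR_ge0 (- b) (p - 1).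
have [h|h] := leP a (- b).
  have : ((a - b) / 2) `^ (p - 1) <= (- b) `^ (p - 1) by apply: le_powR => //; lra.
  lra.
have : ((a - b) / 2) `^ (p - 1) <= a `^ (p - 1) by apply: le_powR => //; lra.
lra.
Qed.

Lemma spow_lip a b : `|spow a - spow b| <=
  (p - 1) * (Num.max `|a| `|b| `^ (p - 2) * `|a - b|).
Proof.
have hp := p_ge2.
wlog ba : a b / b <= a.
  move=> H; have [/H//|/ltW/H] := leP b a.
  by rewrite distrC maxC (distrC b).
wlog a0 : a b ba / 0 <= a.
  move=> H; have [a0|/ltW a0] := leP 0 a; first exact: H.
  have := H (- b) (- a); rewrite lerN2 oppr_ge0 !normrN !spowN maxC.
  have -> : - spow b - - spow a = spow a - spow b by lra.
  have -> : - b - - a = a - b by lra.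
  by apply=> //; exact: le_trans a0.
have ab0 : 0 <= a - b by rewrite subr_ge0.
rewrite [`|a|]ger0_norm// [`|a - b|]ger0_norm//.
have [b0|b0] := leP 0 b.
  rewrite [`|b|]ger0_norm// max_l// !spow_ge0// ger0_norm ?powRBl1//.
  by rewrite subr_ge0 le_powR//; lra.
rewrite [`|b|]ltr0_norm//; set m := Num.max a (- b).
have am : a <= m by rewrite le_max lexx.
have bm : - b <= m by rewrite le_max lexx orbT.
have -> : spow a - spow b = a `^ (p - 2) * a + (- b) `^ (p - 2) * (- b).
  by rewrite /spow ger0_norm// ltr0_norm// mulrN.
have Nb0 : 0 <= - b by lra.
rewrite ger0_norm; last by rewrite addr_ge0// mulr_ge0 ?powR_ge0.
have h1 : a `^ (p - 2) * a <= m `^ (p - 2) * a by rewrite ler_wpM2r// le_powR.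
have h2 : (- b) `^ (p - 2) * (- b) <= m `^ (p - 2) * (- b).
  by rewrite ler_wpM2r// le_powR.
apply: (@le_trans _ _ (m `^ (p - 2) * (a - b))); first lra.
by rewrite ler_peMl ?mulr_ge0 ?powR_ge0//; lra.
Qed.

(** The right-hand side is tailored to the error estimate: the first term is
    absorbed by [spow_mono], the second is controlled by a priori bounds, and [s]
    stays free to balance the last two. *)
Lemma spow_perturb del s a b w : 0 < del -> 0 < s ->
  (spow a - spow b) * w <=
  del * `|a - b| `^ p + (p - 1) * s * (`|a| `^ p + `|b| `^ p) +
  (p - 1) ^+ 2 / del * s `^ (- (p - 2)) * `|w| `^ p.
Proof.
have hp := p_ge2.
move=> del0 s0; apply: le_trans (ler_norm _) _; rewrite normrM.
have L0 : 0 < p - 1 by lra.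
apply: (@le_trans _ _ ((p - 1) * (Num.max `|a| `|b| `^ (p - 2) * `|a - b|) * `|w|)).
  by rewrite ler_wpM2r// spow_lip.
rewrite -[X in X <= _]mulrA -[X in _ * X <= _]mulrA.
have m0 : 0 <= Num.max `|a| `|b| by rewrite le_max normr_ge0.
apply: le_trans (young3_scaled L0 del0 s0 m0 (normr_ge0 _) (normr_ge0 _)) _.
rewrite !lerD2r lerD2l ler_wpM2l// ?mulr_ge0 ?(ltW s0) ?(ltW L0)//.
by rewrite /Num.max; case: ifP => _; rewrite ?lerDl ?lerDr powR_ge0.
Qed.

Lemma spow_mul_le a w : `|spow a * w| <= `|a| `^ p + `|w| `^ p.
Proof.
rewrite normrM /spow normrM (ger0_norm (powR_ge0 _ _)) -mulrA.
set m := Num.max `|a| `|w|.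
have ma : `|a| <= m by rewrite le_max lexx.
have mw : `|w| <= m by rewrite le_max lexx orbT.
have m0 : 0 <= m by exact: le_trans ma.
apply: (@le_trans _ _ (m `^ p)).
  by rewrite powR_pE// expr2 ler_pM ?mulr_ge0 ?powR_ge0 ?le_powR// ler_pM.
by rewrite /m /Num.max; case: ifP => _; rewrite ?lerDl ?lerDr powR_ge0.
Qed.

End signed_power.

Lemma powR_normD (R : realType) (p a b : R) : 0 <= p ->
  `|a + b| `^ p <= 2 `^ p * (`|a| `^ p + `|b| `^ p).
Proof.
move=> p0; set m := Num.max `|a| `|b|.
have ma : `|a| <= m by rewrite le_max lexx.
have mw : `|b| <= m by rewrite le_max lexx orbT.
have m0 : 0 <= m by exact: le_trans ma.
apply: (@le_trans _ _ ((2 * m) `^ p)).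
  apply: le_powR => //; apply: le_trans (ler_normD _ _) _; lra.
rewrite powRM// ler_wpM2l ?powR_ge0//.
by rewrite /m /Num.max; case: ifP => _; rewrite ?lerDl ?lerDr powR_ge0.
Qed.

(** * Lebesgue spaces, Fubini and real-valued integrals *)

Section Lp_generic.
Context dd (X : measurableType dd) (R : realType).
Variables (mu : {measure set X -> \bar R}) (D : set X).
Hypothesis mD : measurable D.
Implicit Types (f g h : X -> R) (q c : R).

Lemma measurable_norm_powR q f :
  measurable_fun D f -> measurable_fun D (fun x => `|f x| `^ q).
Proof.
move=> mf; apply: (measurableT_comp (measurable_powR q)).
exact: measurableT_comp.
Qed.

Lemma le_Rintegrable f g : measurable_fun D f ->
  (forall x, D x -> `|f x| <= g x) ->
  mu.-integrable D (EFin \o g) -> mu.-integrable D (EFin \o f).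
Proof.
move=> mf fg; apply: le_integrable => //; first exact/measurable_EFinP.
move=> x Dx /=; rewrite lee_fin (le_trans (fg x Dx))//.
exact: ler_norm.
Qed.

Lemma in_LpP q f : in_Lp mu D q f <->
  measurable_fun D f /\ mu.-integrable D (EFin \o (fun x => `|f x| `^ q)).
Proof.
split=> -[mf fq]; split => //.
  apply/integrableP; split.
    by apply/measurable_EFinP; exact: measurable_norm_powR.
  rewrite (le_lt_trans _ fq)// le_eqVlt; apply/orP; left; apply/eqP.
  by apply: eq_integral => x _ /=; rewrite (ger0_norm (powR_ge0 _ _)).
move/integrableP : fq => [_]; apply: le_lt_trans.
rewrite le_eqVlt; apply/orP; left; apply/eqP.
by apply: eq_integral => x _ /=; rewrite (ger0_norm (powR_ge0 _ _)).
Qed.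

Lemma in_Lp_integrable q f : in_Lp mu D q f ->
  mu.-integrable D (EFin \o (fun x => `|f x| `^ q)).
Proof. by move=> /in_LpP[]. Qed.

Lemma integrableDr f g : mu.-integrable D (EFin \o f) ->
  mu.-integrable D (EFin \o g) ->
  mu.-integrable D (EFin \o (fun x => f x + g x)).
Proof. by move=> ? ?; exact: (@integrableD _ _ _ mu D mD (EFin \o f) (EFin \o g)). Qed.

Lemma integrableBr f g : mu.-integrable D (EFin \o f) ->
  mu.-integrable D (EFin \o g) ->
  mu.-integrable D (EFin \o (fun x => f x - g x)).
Proof. by move=> ? ?; exact: (@integrableB _ _ _ mu D mD (EFin \o f) (EFin \o g)). Qed.

Lemma integrableZlr c f : mu.-integrable D (EFin \o f) ->
  mu.-integrable D (EFin \o (fun x => c * f x)).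
Proof. by move=> ?; exact: (@integrableZl _ _ _ mu D mD c (EFin \o f)). Qed.

Lemma in_Lp_le q c f g : 0 <= q -> measurable_fun D f -> 0 <= c ->
  (forall x, D x -> `|f x| <= c * `|g x|) -> in_Lp mu D q g -> in_Lp mu D q f.
Proof.
move=> q0 mf c0 fg /in_Lp_integrable/(integrableZlr (c `^ q)) ig.
apply/in_LpP; split=> //; apply: le_Rintegrable ig.
  exact: measurable_norm_powR.
move=> x Dx; rewrite (ger0_norm (powR_ge0 _ _)) -powRM//.
by apply: le_powR => //; exact: fg.
Qed.

Lemma eq_in_Lp q f g : (forall x, D x -> f x = g x) ->
  in_Lp mu D q f -> in_Lp mu D q g.
Proof.
move=> fg [mf lf]; split.
  by apply: eq_measurable_fun mf => x; rewrite inE; exact: fg.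
by rewrite (eq_integral (fun x => (`|f x| `^ q)%:E))// => x; rewrite inE => /fg ->.
Qed.

Lemma in_LpD q f g : 0 <= q -> in_Lp mu D q f -> in_Lp mu D q g ->
  in_Lp mu D q (fun x => f x + g x).
Proof.
move=> q0 lf lg; apply/in_LpP.
have mfg : measurable_fun D (fun x => f x + g x).
  by apply: measurable_funD; [case: lf|case: lg].
split=> //.
have := integrableZlr (2 `^ q)
  (integrableDr (in_Lp_integrable lf) (in_Lp_integrable lg)).
apply: le_Rintegrable; first exact: measurable_norm_powR.
by move=> x _; rewrite (ger0_norm (powR_ge0 _ _)) powR_normD.
Qed.

Lemma in_LpZ q c f : 0 <= q -> in_Lp mu D q f -> in_Lp mu D q (fun x => c * f x).
Proof.
move=> q0 lf; apply: (@in_Lp_le _ `|c| _ f) => //.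
  by apply: measurable_funM => //; case: lf.
by move=> x _; rewrite normrM.
Qed.

Lemma in_LpB q f g : 0 <= q -> in_Lp mu D q f -> in_Lp mu D q g ->
  in_Lp mu D q (fun x => f x - g x).
Proof.
move=> q0 lf /(in_LpZ (-1) q0)/(in_LpD q0 lf); apply: eq_in_Lp => x _.
by rewrite mulN1r.
Qed.

Lemma in_Lp_lin q c f g : 0 <= q -> in_Lp mu D q f -> in_Lp mu D q g ->
  in_Lp mu D q (fun x => c * f x + g x).
Proof. by move=> q0 lf lg; exact: (in_LpD q0 (in_LpZ c q0 lf) lg). Qed.

Lemma in_Lp0 q : 0 < q -> in_Lp mu D q (fun=> 0).
Proof.
move=> q0; split => //.
under eq_integral do rewrite normr0 powR0 ?gt_eqF//.
by rewrite integral0.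
Qed.

Lemma in_Lp_norm q f : in_Lp mu D q f -> in_Lp mu D q (fun x => `|f x|).
Proof.
move=> [mf lf]; split; first exact: measurableT_comp.
by under eq_integral do rewrite normr_id.
Qed.

Lemma in_Lp_sum q I (s : seq I) (F : I -> X -> R) : 0 < q ->
  (forall i, in_Lp mu D q (F i)) -> in_Lp mu D q (fun x => \sum_(i <- s) F i x).
Proof.
move=> q0 lF; elim: s => [|i s ih].
  by apply: eq_in_Lp (in_Lp0 q0) => x _; rewrite big_nil.
by apply: eq_in_Lp (in_LpD (ltW q0) (lF i) ih) => x _; rewrite big_cons.
Qed.

Lemma powR2_norm (x : R) : `|x| `^ 2 = x ^+ 2.
Proof. by rewrite powR_mulrn// real_normK ?num_real. Qed.

Lemma in_L2_mul f g : in_Lp mu D 2 f -> in_Lp mu D 2 g ->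
  mu.-integrable D (EFin \o (fun x => f x * g x)).
Proof.
move=> lf lg; have := integrableDr (in_Lp_integrable lf) (in_Lp_integrable lg).
apply: le_Rintegrable; first by apply: measurable_funM; [case: lf|case: lg].
move=> x _; rewrite !powR2_norm normrM.
have h : 0 <= (`|f x| - `|g x|) ^+ 2 by rewrite sqr_ge0.
have := mulr_ge0 (normr_ge0 (f x)) (normr_ge0 (g x)).
rewrite -(real_normK (num_real (f x))) -(real_normK (num_real (g x))).
nra.
Qed.

Lemma in_L2_sqr f : in_Lp mu D 2 f ->
  mu.-integrable D (EFin \o (fun x => f x ^+ 2)).
Proof. by move=> lf; exact: in_L2_mul. Qed.

Lemma in_Lp_spow_mul q f g : 2 <= q -> in_Lp mu D q f -> in_Lp mu D q g ->
  mu.-integrable D (EFin \o (fun x => spow q (f x) * g x)).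
Proof.
move=> q2 lf lg.
have := integrableDr (in_Lp_integrable lf) (in_Lp_integrable lg).
apply: le_Rintegrable; last by move=> x _; exact: spow_mul_le.
have [mf _] := lf; have [mg _] := lg.
by do 2 apply: measurable_funM => //; exact: measurable_norm_powR.
Qed.

Lemma ae_eq_Rintegral f g : measurable_fun D f -> measurable_fun D g ->
  {ae mu, forall x, D x -> f x = g x} ->
  \int[mu]_(x in D) f x = \int[mu]_(x in D) g x.
Proof.
move=> mf mg fg; congr fine; apply: ae_eq_integral => //.
- exact/measurable_EFinP.
- exact/measurable_EFinP.
- by apply: filterS fg => x h Dx; rewrite h.
Qed.

(** Almost everywhere [|f|^q <= M^(q-2) f^2], so the integrability of the square
    passes to the power [q]. *)
Lemma bounded_in_Lp q M f : 2 <= q -> in_Lp mu D 2 f ->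
  {ae mu, forall x, D x -> `|f x| <= M} -> in_Lp mu D q f.
Proof.
move=> q2 lf fM; have [mf _] := lf; split=> //.
have [_ ] := in_LpZ (Num.sqrt (`|M| `^ (q - 2))) (ltW (ltr0n _ 2)) lf.
apply: le_lt_trans.
apply: ae_ge0_le_integral => //.
- by apply/measurable_EFinP; exact: measurable_norm_powR.
- apply/measurable_EFinP; apply: measurable_norm_powR.
  exact: measurable_funM.
apply: filterS fM => x h Dx; have {h} h := h Dx.
rewrite lee_fin powR2_norm exprMn sqr_sqrtr ?powR_ge0//.
rewrite powR_pE// real_normK ?num_real// ler_wpM2r ?sqr_ge0//.
apply: le_powR => //; first by rewrite subr_ge0.
by rewrite (le_trans h)// ler_norm.
Qed.

End Lp_generic.

Section ae_order.
Context dd (X : measurableType dd) (R : realType).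
Variables (mu : {measure set X -> \bar R}) (D : set X).
Hypothesis mD : measurable D.

Lemma ae_eq_integrable (f g : X -> \bar R) :
  measurable_fun D f -> measurable_fun D g ->
  {ae mu, forall x, D x -> f x = g x} ->
  mu.-integrable D g -> mu.-integrable D f.
Proof.
move=> mf mg fg /integrableP[_ gi]; apply/integrableP; split => //.
apply: le_lt_trans gi; rewrite le_eqVlt; apply/orP; left; apply/eqP.
apply: ae_eq_integral => //.
- exact: measurableT_comp.
- exact: measurableT_comp.
- by apply: filterS fg => x h Dx; rewrite h.
Qed.

(** The pointwise minimum of [f] and [g] agrees with [f] almost everywhere and
    lies below [g] everywhere. *)
Lemma ae_le_Rintegral (f g : X -> R) :
  mu.-integrable D (EFin \o f) -> mu.-integrable D (EFin \o g) ->
  {ae mu, forall x, D x -> f x <= g x} ->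
  \int[mu]_(x in D) f x <= \int[mu]_(x in D) g x.
Proof.
move=> fi gi fg.
pose m x := Num.min (f x) (g x).
have mf : measurable_fun D f by apply/measurable_EFinP; exact: (measurable_int _ fi).
have mg : measurable_fun D g by apply/measurable_EFinP; exact: (measurable_int _ gi).
have mm : measurable_fun D m by exact: measurable_minr.
have mE : {ae mu, forall x, D x -> f x = m x}.
  by apply: filterS fg => x h Dx; rewrite /m min_l// h.
rewrite (ae_eq_Rintegral mD mf mm mE).
apply: le_Rintegral => //.
  apply: (ae_eq_integrable _ _ _ fi).
  - exact/measurable_EFinP.
  - exact/measurable_EFinP.
  - by apply: filterS mE => x h Dx /=; rewrite h.
by move=> x _; rewrite /m ge_min lexx orbT.
Qed.

End ae_order.

Section fubini_real.
Context d1 d2 (X : measurableType d1) (Y : measurableType d2) (R : realType).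
Variables (m1 : {sigma_finite_measure set X -> \bar R})
  (m2 : {sigma_finite_measure set Y -> \bar R}).
Variables (A : set X) (B : set Y).
Hypotheses (mA : measurable A) (mB : measurable B).

Lemma patch_prod_section (h : X * Y -> \bar R) x y : A x ->
  (h \_ (A `*` B)) (x, y) = ((fun y => h (x, y)) \_ B) y.
Proof.
move=> Ax; rewrite !patchE.
have [By|By] := pselect (B y); first by rewrite !mem_set.
by rewrite !memNset// => -[].
Qed.

(** The real-valued inner integral takes the default value [0] where the section
    of [h] is not integrable; this happens on a null set only, and the inner
    integral is measurable nonetheless because it is the finite part of the
    extended one. *)
Lemma Rfubini (h : X * Y -> R) :
  (m1 \x m2)%E.-integrable (A `*` B) (EFin \o h) ->
  [/\ {ae m1, forall x, A x -> m2.-integrable B (fun y => (h (x, y))%:E)},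
      m1.-integrable A (fun x => (\int[m2]_(y in B) h (x, y))%:E) &
      \int[m1]_(x in A) (\int[m2]_(y in B) h (x, y)) =
      \int[(m1 \x m2)%E]_(z in A `*` B) h z].
Proof.
have mAB : measurable (A `*` B) by exact: measurableX.
move=> ih.
have ih' := (integrable_mkcond (EFin \o h) mAB).1 ih.
set g := (EFin \o h) \_ (A `*` B) in ih'.
pose F := fubini_F m2 g.
have iF : m1.-integrable setT F by exact: integrable_fubini_F.
have FE x : A x -> F x = (\int[m2]_(y in B) (h (x, y))%:E)%E.
  move=> Ax; rewrite /F /fubini_F [RHS]integral_mkcond; apply: eq_integral => y _.
  exact: patch_prod_section.
have FnE x : ~ A x -> F x = 0%E.
  move=> Ax; rewrite /F /fubini_F; apply: integral0_eq => y _.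
  by rewrite /g patchE memNset// => -[].
have ae1 := ae_integrable1 ih'.
have fine1 x : A x -> m2.-integrable B (fun y => (h (x, y))%:E) ->
    F x = (\int[m2]_(y in B) h (x, y))%:E.
  by move=> Ax ix; rewrite FE// /Rintegral fineK//; exact: integrable_fin_num.
have aeA : {ae m1, forall x, A x -> m2.-integrable B (fun y => (h (x, y))%:E)}.
  apply: filterS ae1 => x ix Ax.
  apply/(integrable_mkcond _ mB); apply: eq_integrable ix => // y _.
  exact: patch_prod_section.
have mR : measurable_fun A (fun x => \int[m2]_(y in B) h (x, y)).
  apply: (@eq_measurable_fun _ _ _ _ _ (fine \o F)).
    by move=> x; rewrite inE => Ax /=; rewrite FE.
  apply: measurableT_comp => //.
  by apply: measurable_funTS; exact: (measurable_int m1 iF).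
have iFA : m1.-integrable A F by exact: (integrableS measurableT).
have aeE : {ae m1, forall x, A x -> F x = (\int[m2]_(y in B) h (x, y))%:E}.
  by apply: filterS aeA => x hx Ax; exact/fine1/hx.
have iR : m1.-integrable A (fun x => (\int[m2]_(y in B) h (x, y))%:E).
  apply/integrableP; split; first exact/measurable_EFinP.
  move/integrableP : (iFA) => [mF]; apply: le_lt_trans.
  rewrite le_eqVlt; apply/orP; left; apply/eqP; apply: ae_eq_integral => //.
  - by apply: measurableT_comp => //; exact/measurable_EFinP.
  - exact: measurableT_comp.
  - by apply: filterS aeE => x hx Ax; rewrite hx.
split=> //.
rewrite /Rintegral; congr fine.
transitivity (\int[m1]_(x in A) F x)%E.
  apply: ae_eq_integral => //.
  - exact/measurable_EFinP.
  - exact: (measurable_int m1 iFA).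
  - by apply: filterS aeE => x hx Ax; rewrite hx.
rewrite [RHS]integral_mkcond -(integral12_prod_meas1 ih') integral_mkcond.
apply: eq_integral => x _; rewrite patchE; case: ifPn => //.
by move=> /negP xA; apply/esym/FnE => Ax; apply: xA; rewrite inE.
Qed.

Lemma in_Lp_snd q (v : Y -> R) : (m1 A < +oo)%E -> in_Lp m2 B q v ->
  in_Lp (m1 \x m2)%E (A `*` B) q (fun z => v z.2).
Proof.
have mAB : measurable (A `*` B) by exact: measurableX.
move=> A_fin [mv lv].
have mv2 : measurable_fun (A `*` B) (fun z : X * Y => v z.2).
  apply: (measurable_comp mB) => //.
  - by move=> _ [[x y] [Ax By] <-].
  - exact: measurable_funTS.
split=> //.
pose g (z : X * Y) : \bar R := (EFin \o (fun z => `|v z.2| `^ q)) \_ (A `*` B) z.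
have mg : measurable_fun setT g.
  apply/(measurable_restrictT _ mAB)/measurable_EFinP.
  exact: (measurable_norm_powR q).
have g0 z : (0 <= g z)%E.
  by rewrite /g patchE; case: ifPn => // _; rewrite lee_fin powR_ge0.
rewrite integral_mkcond (fubini_tonelli1 _ mg g0).
rewrite (_ : (\int[m1]_x _)%E =
  (\int[m1]_(x in A) (cst (\int[m2]_(y in B) (`|v y| `^ q)%:E) x))%E).
  rewrite integral_cst// lte_mul_pinfty//.
    by apply: integral_ge0 => y _; rewrite lee_fin powR_ge0.
  rewrite fin_numElt lv andbT (lt_le_trans (ltNye 0))//.
  by apply: integral_ge0 => y _; rewrite lee_fin powR_ge0.
rewrite [RHS]integral_mkcond; apply: eq_integral => x _.
rewrite patchE; case: ifPn => [|/negP] xA.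
  rewrite inE in xA.
  rewrite /fubini_F [RHS]integral_mkcond; apply: eq_integral => y _.
  exact: patch_prod_section.
rewrite /fubini_F; apply: integral0_eq => y _.
by rewrite /g patchE memNset// => -[Ax _]; apply: xA; rewrite inE.
Qed.

End fubini_real.

(** * Lebesgue measure and polyhedral domains in euclidean space *)

Section euclidean_measurability.
Variables (R : realType) (n : nat).
Implicit Types (A : set 'rV[R]_n).

Lemma measurable_rV_ball (c : 'rV[R]_n) (r : R) : measurable (ball c r).
Proof.
have [r0|r0] := leP r 0.
  rewrite (_ : ball c r = set0)//; apply/seteqP; split => // y [].
  by rewrite ltNge r0.
rewrite (_ : ball c r = \big[setI/setT]_(i < n)
    ((fun x : 'rV[R]_n => x ord0 i) @^-1` ball (c ord0 i) r)); last first.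
  apply/seteqP; split => [y [_ cy]|y].
    by rewrite -bigcap_seq => i _; exact: cy.
  rewrite -bigcap_seq => cy; split => // i j; rewrite (ord1 i).
  by apply: cy; rewrite /= mem_index_enum.
apply: bigsetI_measurable => i _.
rewrite -[X in measurable X]setTI; apply: measurable_rV_coord => //.
exact: measurable_ball.
Qed.

(** Every open set is the union of the balls it contains that have rational
    centre and radius [1/(k+1)]. *)
Lemma open_measurable_rV A : open A -> measurable A.
Proof.
move=> oA.
pose B (q : 'rV[rat]_n * nat) : set 'rV[R]_n :=
  ball (map_mx ratr q.1 : 'rV[R]_n) q.2.+1%:R^-1.
pose F q := if pselect (B q `<=` A) then B q else set0.
rewrite (_ : A = \bigcup_q F q).
  apply: countable_bigcupT_measurable; first exact: countableP.
  by move=> q; rewrite /F; case: (pselect (B q `<=` A)) => h; 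
    [exact: measurable_rV_ball|exact: measurable0].
apply/seteqP; split => [x Ax|x [q _]]; last first.
  by rewrite /F; case: pselect => // h; exact: h.
have /nbhs_ballP [e /= e0 xeA] : nbhs x A by exact: open_nbhs_nbhs.
have e20 : 0 < e / 2 by rewrite divr_gt0.
have [k ke] : exists k : nat, k.+1%:R^-1 < e / 2.
  exists (Num.truncn (e / 2)^-1).
  rewrite invf_plt ?posrE// ?ltr0n//.
  exact: truncnS_gt.
have k0 : 0 < k.+1%:R^-1 :> R by rewrite invr_gt0 ltr0n.
have /choice [q xq] : forall i : 'I_n, exists q : rat,
    ball (x ord0 i) k.+1%:R^-1 (ratr q).
  move=> i; have /rat_in_itvoo[q] : x ord0 i < x ord0 i + k.+1%:R^-1 by rewrite ltrDl.
  rewrite in_itv/= => /andP[q1 q2]; exists q; rewrite -ball_normE/= ltr_norml.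
  by move: (k.+1%:R^-1) k0 q2 => r k0 q2; apply/andP; split; lra.
pose Q : 'rV[rat]_n := \row_i q i.
exists (Q, k) => //; rewrite /F; case: pselect => [h|].
  split=> // i j; rewrite (ord1 i) mxE mxE; exact/ball_sym/xq.
case=> y [_ Qy]; apply: xeA; split => // i j; rewrite (ord1 i) (splitr e).
have := Qy ord0 j; have := xq j; rewrite !mxE -!ball_normE/= => xqj qyj.
have -> : x ord0 j - y ord0 j = (x ord0 j - ratr (q j)) + (ratr (q j) - y ord0 j).
  by rewrite addrA subrK.
by apply: le_lt_trans (ler_normD _ _) _; apply: ltrD; exact: lt_trans ke.
Qed.

Lemma continuous_measurable_rV (f : 'rV[R]_n -> R) :
  continuous f -> measurable_fun setT f.
Proof.
move=> /continuousP cf; apply: (measurability _ (RGenOpens.measurableE R)).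
move=> _ [_ [a [b ->] <-]]; rewrite setTI; apply: open_measurable_rV.
exact/cf/interval_open.
Qed.

End euclidean_measurability.

Section bounded_sets.
Variable R : realType.

(** The closed ball of the maximum norm, in a form that splits along the
    coordinates used to build the Lebesgue measure. *)
Definition box n (M : R) : set 'rV[R]_n := [set x | forall i, `|x ord0 i| <= M].

Lemma box_compact n M : compact (@box n M).
Proof.
rewrite (_ : box M = [set v : 'rV[R]_n | forall i, v ord0 i \in `[- M, M]]).
  apply: (@rV_compact _ _ (fun=> `[- M, M]%classic)) => _.
  exact: segment_compact.
by apply/seteqP; split => v h i; have := h i; rewrite in_itv/= ler_norml.
Qed.

Lemma box_measurable n M : measurable (@box n M).
Proof.
rewrite -(setCK (box M)); apply: measurableC; apply: open_measurable_rV.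
rewrite openC; apply: compact_closed; last exact: box_compact.
exact: norm_hausdorff.
Qed.

Lemma lebesgue_box n M : (lebesgue_rV R n (@box n M) < +oo)%E.
Proof.
elim: n => [|n ih].
  by rewrite /= diracE; case: (_ \in _) => /=; rewrite ltry.
rewrite /= /lebesgue_rVS /pushforward.
rewrite (_ : _ @^-1` _ = `[- M, M]%classic `*` box M).
  rewrite product_measure1E//; last exact: box_measurable.
  have h : (@lebesgue_measure R `[(- M)%R, M]%classic < +oo)%E.
    by rewrite lebesgue_measure_itv/=; case: ifP => // _; rewrite ltry.
  by apply: lte_mul_pinfty => //; rewrite ge0_fin_numE.
apply/seteqP; split => [[a y] h|[a y] [/= ah h] i].
  split.
    by have := h ord0; rewrite mxE unlift_none/= in_itv/= ler_norml.
  by move=> j; have := h (lift ord0 j); rewrite mxE liftK.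
rewrite mxE; case: unliftP => [j _|_] /=; first exact: h.
by move: ah; rewrite in_itv/= ler_norml.
Qed.

Lemma convex_hull_box n k (P : 'I_k -> 'rV[R]_n) :
  exists M, convex_hull P `<=` box M.
Proof.
exists (\sum_j \sum_i `|P j ord0 i|) => _ [c [c0 c1 ->]] i.
rewrite summxE; apply: le_trans (ler_norm_sum _ _ _) _.
apply: ler_sum => j _; rewrite mxE normrM ger0_norm//.
have cj1 : c j <= 1.
  by rewrite -c1 (bigD1 j)//= lerDl sumr_ge0.
apply: (@le_trans _ _ `|P j ord0 i|); first by rewrite ler_piMl.
by rewrite (bigD1 i)//= lerDl sumr_ge0.
Qed.

Lemma bigcup_box n k (P : 'I_k -> set 'rV[R]_n) :
  (forall j, exists M, P j `<=` box M) -> exists M, \bigcup_j P j `<=` box M.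
Proof.
move=> /choice[M PM]; exists (\sum_j `|M j|) => x [j _ /PM h] i.
apply: le_trans (h i) _; apply: le_trans (ler_norm _) _.
by rewrite (bigD1 j)//= lerDl sumr_ge0.
Qed.

Lemma poly_fun_bounded n s (q : 'rV[R]_n -> R) (M : R) : poly_fun s q ->
  exists C, forall x, box M x -> `|q x| <= C.
Proof.
move=> [c qE].
exists (\sum_(a : {ffun 'I_n -> 'I_s.+1} | (\sum_i a i <= s)%N)
          `|c a| * \prod_(i < n) M ^+ a i) => x Mx.
rewrite qE; apply: le_trans (ler_norm_sum _ _ _) _.
apply: ler_sum => a _; rewrite normrM ler_wpM2l// normr_prod.
apply: ler_prod => i _; rewrite normr_ge0/= normrX lerXn2r ?nnegrE//.
by rewrite (le_trans _ (Mx i)).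
Qed.

End bounded_sets.

Section polyhedral.
Variables (R : realType) (d : nat) (Omega : set 'rV[R]_d).
Hypothesis pO : polyhedral_domain Omega.

Lemma polyhedral_measurable : measurable Omega.
Proof.
case: pO => _ _ [k [P [_ ->]]]; apply: open_measurable_rV; exact: open_interior.
Qed.

Lemma polyhedral_box : exists M, Omega `<=` box M.
Proof.
case: pO => _ _ [k [P [pP ->]]].
have [|M hM] := @bigcup_box R d k P.
  by move=> j; have [[l [Q ->]] _] := pP j; exact: convex_hull_box.
by exists M; apply: subset_trans hM; exact: interior_subset.
Qed.

Lemma polyhedral_finite : (lebesgue_rV R d Omega < +oo)%E.
Proof.
have [M OM] := polyhedral_box.
apply: le_lt_trans (lebesgue_box d M).
apply: le_measure => //; rewrite inE; first exact: polyhedral_measurable.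
exact: box_measurable.
Qed.

(** A box containing [Omega] is compact, so [f] is bounded on a set of finite
    measure. *)
Lemma continuous_in_L2 (f : 'rV[R]_d -> R) : continuous f -> L2 Omega f.
Proof.
move=> cf; have [M OM] := polyhedral_box.
have mf : measurable_fun Omega f.
  by apply: measurable_funTS; exact: continuous_measurable_rV.
apply/in_LpP; split => //.
apply: measurable_bounded_integrable.
- exact: polyhedral_measurable.
- exact: polyhedral_finite.
- exact: measurable_norm_powR.
have /compact_bounded[C [_ CP]] : compact (f @` box M).
  apply: continuous_compact; last exact: box_compact.
  exact: continuous_subspaceT.
exists ((`|C| + 1) ^+ 2); split; first exact: num_real.
move=> N /ltW hN x Ox /=; rewrite (ger0_norm (powR_ge0 _ _)) powR2_norm.
apply: le_trans hN; rewrite -real_normK ?num_real// lerXn2r ?nnegrE ?addr_ge0//.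
apply: (CP (`|C| + 1)); last by exists x => //; exact: OM.
by rewrite ltr_pwDr// ler_norm.
Qed.

End polyhedral.

(** * Test functions *)

Section test_function_space.
Variables (R : realType) (V : normedModType R).
Implicit Types (f g : V -> R) (U : set V).

Lemma iter_derive_lin a f g : smooth f -> smooth g -> forall vs,
  iter_derive vs (fun x => a * f x + g x) =
  (fun x => a * iter_derive vs f x + iter_derive vs g x).
Proof.
move=> sf sg; elim=> [//|v vs ih]; rewrite /= -/(iter_derive vs _) ih.
apply/funext => x.
have df := (sf vs).2 x v; have dg := (sg vs).2 x v.
have -> : (fun x => a * iter_derive vs f x + iter_derive vs g x) =
  (a \*: iter_derive vs f) + iter_derive vs g by [].
by rewrite (deriveD (derivableZ df) dg) (deriveZ _ df).
Qed.

Lemma smooth_lin a f g : smooth f -> smooth g -> smooth (fun x => a * f x + g x).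
Proof.
move=> sf sg vs; rewrite iter_derive_lin//; split.
  move=> x; apply: cvgD; last exact: (sg vs).1.
  by apply: cvgM; [exact: cvg_cst|exact: (sf vs).1].
move=> x v.
have -> : (fun x => a * iter_derive vs f x + iter_derive vs g x) =
  (a \*: iter_derive vs f) + iter_derive vs g by [].
by apply: derivableD; [apply: derivableZ; exact: (sf vs).2|exact: (sg vs).2].
Qed.

Lemma smooth0 : smooth (fun _ : V => 0 : R).
Proof.
have h vs : iter_derive vs (fun _ : V => 0 : R) = (fun=> 0).
  elim: vs => [//|v vs ih]; rewrite /= -/(iter_derive vs _) ih.
  by apply/funext => x; exact: derive_cst.
move=> vs; rewrite h; split; first by move=> x; exact: cvg_cst.
by move=> x v; exact: derivable_cst.
Qed.

Lemma Cc_infty_lin U a f g : Cc_infty U f -> Cc_infty U g ->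
  Cc_infty U (fun x => a * f x + g x).
Proof.
move=> [sf cf fU] [sg cg gU].
have sub : closure [set x | a * f x + g x != 0] `<=`
    closure [set x | f x != 0] `|` closure [set x | g x != 0].
  rewrite -closureU; apply: closureS => x /=; apply: contraNP.
  by move=> /not_orP[/negP/negPn/eqP -> /negP/negPn/eqP ->]; rewrite mulr0 addr0.
split; first exact: smooth_lin.
  apply: subclosed_compact sub; first exact: closed_closure.
  exact: compactU.
by move=> x /sub[/fU|/gU].
Qed.

Lemma Cc_infty0 U : Cc_infty U (fun=> 0).
Proof.
have E : [set x : V | (0 : R) != 0] = set0.
  by apply/seteqP; split => // x /=; rewrite eqxx.
split; first exact: smooth0.
  by rewrite E closure0; exact: compact0.
by rewrite E closure0.
Qed.

End test_function_space.

(** * The space of weakly differentiable functions vanishing on the boundary *)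

Lemma budget_lt (R : realType) (a e n1 n2 n3 n4 : R) : 0 < e ->
  n1 + n2 < e / (4 * (`|a| + 1)) -> n3 + n4 < e / (4 * (`|a| + 1)) ->
  2 * (`|a| * n1 + n3) + 2 * (`|a| * n2 + n4) < e.
Proof.
move=> e0; set de := e / _ => h12 h34.
have h1 : `|a| * (n1 + n2) <= `|a| * de := ler_wpM2l (normr_ge0 a) (ltW h12).
have : 2 * (`|a| * de + de) = e / 2.
  by rewrite /de; field; rewrite gt_eqF// ltr_pwDr.
lra.
Qed.

Section sobolev.
Variables (R : realType) (d : nat) (Omega : set 'rV[R]_d).
Hypothesis pO : polyhedral_domain Omega.
Local Notation E := 'rV[R]_d.
Local Notation lebx := (lebesgue_rV R d).
Let mO : measurable Omega. Proof. exact: polyhedral_measurable. Qed.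
Implicit Types (v w : E -> R) (G H : E -> E).

Lemma L2_lin a v w : L2 Omega v -> L2 Omega w ->
  L2 Omega (fun x => a * v x + w x).
Proof. by move=> lv lw; exact: (in_Lp_lin mO a (ler0n _ 2) lv lw). Qed.

Lemma L2B v w : L2 Omega v -> L2 Omega w -> L2 Omega (fun x => v x - w x).
Proof. by move=> lv lw; exact: (in_LpB mO (ler0n _ 2) lv lw). Qed.

Lemma in_L2_dotv dd (X : measurableType dd) (mu : {measure set X -> \bar R})
    (D : set X) (G H : X -> E) : measurable D ->
  (forall i, in_Lp mu D 2 (fun x => G x ord0 i)) ->
  (forall i, in_Lp mu D 2 (fun x => H x ord0 i)) ->
  mu.-integrable D (EFin \o (fun x => dotv (G x) (H x))).
Proof.
move=> mD lG lH.
rewrite (_ : EFin \o _ = fun x => (\sum_i (G x ord0 i * H x ord0 i)%:E)%E).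
  by apply: integrable_sum => // i _; exact: in_L2_mul.
by apply/funext => x; rewrite /= sumEFin.
Qed.

Lemma normL2_ge0 v : 0 <= normL2 Omega v. Proof. exact: sqrtr_ge0. Qed.
Lemma normL2v_ge0 G : 0 <= normL2v Omega G. Proof. exact: sqrtr_ge0. Qed.

Lemma normL2_sqr v : normL2 Omega v ^+ 2 = ip Omega v v.
Proof. by rewrite sqr_sqrtr// Rintegral_ge0// => x _; rewrite -expr2 sqr_ge0. Qed.

Lemma dotv_ge0 (x : E) : 0 <= dotv x x.
Proof. by apply: sumr_ge0 => i _; rewrite -expr2 sqr_ge0. Qed.

Lemma normL2v_sqr G : normL2v Omega G ^+ 2 = ipv Omega G G.
Proof. by rewrite sqr_sqrtr// Rintegral_ge0// => x _; exact: dotv_ge0. Qed.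

Lemma normL2_le c v w : L2 Omega v -> L2 Omega w -> 0 <= c ->
  (forall x, Omega x -> `|v x| <= c * `|w x|) ->
  normL2 Omega v <= c * normL2 Omega w.
Proof.
move=> lv lw c0 vw.
rewrite -(ger0_norm c0) -sqrtr_sqr /normL2 -sqrtrM ?sqr_ge0// ler_wsqrtr//.
rewrite /ip -(RintegralZl _ mO (in_L2_mul mO lw lw)).
apply: (le_Rintegral mO (in_L2_mul mO lv lv)
  (integrableZlr mO _ (in_L2_mul mO lw lw))).
move=> x Ox; rewrite -!expr2 -exprMn -(real_normK (num_real (v x))).
rewrite -(real_normK (num_real (c * w x))) lerXn2r ?nnegrE//.
by rewrite normrM (ger0_norm c0) vw.
Qed.

Lemma sqrt_Rintegral_le a (q q1 q2 : E -> R) :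
  (forall x, Omega x -> 0 <= q1 x) -> (forall x, Omega x -> 0 <= q2 x) ->
  lebx.-integrable Omega (EFin \o q) ->
  lebx.-integrable Omega (EFin \o q1) -> lebx.-integrable Omega (EFin \o q2) ->
  (forall x, Omega x -> q x <= 2 * a ^+ 2 * q1 x + 2 * q2 x) ->
  Num.sqrt (\int[lebx]_(x in Omega) q x) <=
  2 * (`|a| * Num.sqrt (\int[lebx]_(x in Omega) q1 x) +
       Num.sqrt (\int[lebx]_(x in Omega) q2 x)).
Proof.
move=> q10 q20 iq iq1 iq2 qq.
set S1 := Num.sqrt (\int[lebx]_(x in Omega) q1 x).
set S2 := Num.sqrt (\int[lebx]_(x in Omega) q2 x).
have S10 : 0 <= `|a| * S1 by rewrite mulr_ge0// sqrtr_ge0.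
have S20 : 0 <= S2 by rewrite sqrtr_ge0.
have r0 : 0 <= 2 * (`|a| * S1 + S2) by rewrite mulr_ge0// addr_ge0.
rewrite -[leRHS]ger0_norm// -sqrtr_sqr ler_wsqrtr//.
have h : \int[lebx]_(x in Omega) q x <= 2 * a ^+ 2 * S1 ^+ 2 + 2 * S2 ^+ 2.
  rewrite !sqr_sqrtr ?Rintegral_ge0// -!RintegralZl// -RintegralD//.
  - apply: le_Rintegral => //.
    by apply: integrableDr => //; exact: integrableZlr.
  - exact: integrableZlr.
  - exact: integrableZlr.
apply: le_trans h _.
rewrite -(real_normK (num_real a)); nra.
Qed.

(** A crude substitute for Minkowski's inequality: the factor [2] is harmless
    when the norms on the right can be made arbitrarily small. *)
Lemma normL2_lin a v w : L2 Omega v -> L2 Omega w ->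
  normL2 Omega (fun x => a * v x + w x) <=
  2 * (`|a| * normL2 Omega v + normL2 Omega w).
Proof.
move=> lv lw; apply: sqrt_Rintegral_le.
- by move=> x _; rewrite -expr2 sqr_ge0.
- by move=> x _; rewrite -expr2 sqr_ge0.
- exact: (in_L2_mul mO (L2_lin a lv lw) (L2_lin a lv lw)).
- exact: (in_L2_mul mO lv lv).
- exact: (in_L2_mul mO lw lw).
move=> x _; have := sqr_ge0 (a * v x - w x); lra.
Qed.

Lemma normL2v_lin a G H :
  (forall i, L2 Omega (fun x => G x ord0 i)) ->
  (forall i, L2 Omega (fun x => H x ord0 i)) ->
  normL2v Omega (fun x => a *: G x + H x) <=
  2 * (`|a| * normL2v Omega G + normL2v Omega H).
Proof.
move=> lG lH; apply: sqrt_Rintegral_le.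
- by move=> x _; exact: dotv_ge0.
- by move=> x _; exact: dotv_ge0.
- have l i : L2 Omega (fun x => (a *: G x + H x) ord0 i).
    apply: (@eq_in_Lp _ _ _ _ _ _ (fun x => a * G x ord0 i + H x ord0 i)).
      by move=> x _; rewrite !mxE.
    exact: (L2_lin a (lG i) (lH i)).
  exact: (in_L2_dotv mO l l).
- exact: (in_L2_dotv mO lG lG).
- exact: (in_L2_dotv mO lH lH).
move=> x _; rewrite /dotv !mulr_sumr -big_split/=; apply: ler_sum => i _.
by rewrite !mxE; have := sqr_ge0 (a * G x ord0 i - H x ord0 i); lra.
Qed.

Lemma eq_normL2 v w : (forall x, Omega x -> v x = w x) ->
  normL2 Omega v = normL2 Omega w.
Proof.
by move=> vw; congr Num.sqrt; apply: eq_Rintegral => x; rewrite inE => /vw ->.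
Qed.

Lemma eq_normL2v G H : (forall x, Omega x -> G x = H x) ->
  normL2v Omega G = normL2v Omega H.
Proof.
by move=> vw; congr Num.sqrt; apply: eq_Rintegral => x; rewrite inE => /vw ->.
Qed.

Lemma eq_ip v v' w w' : (forall x, Omega x -> v x = v' x) ->
  (forall x, Omega x -> w x = w' x) -> ip Omega v w = ip Omega v' w'.
Proof.
move=> vv ww; apply: eq_Rintegral => x; rewrite inE => Ox.
by rewrite vv// ww.
Qed.

Lemma eq_H10 v w G H : (forall x, Omega x -> v x = w x) ->
  (forall x, Omega x -> G x = H x) -> H10 Omega v G -> H10 Omega w H.
Proof.
move=> vw GH [[lv lG wG] vG]; split.
  split.
  - exact: eq_in_Lp lv.
  - by move=> i; apply: eq_in_Lp (lG i) => x Ox; rewrite GH.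
  - move=> i psi cpsi; rewrite -(@eq_ip v w (fun x => gradient psi x ord0 i))//.
    rewrite wG//; congr (- _); apply: eq_ip => // x Ox; by rewrite GH.
move=> e /vG[psi cpsi h]; exists psi => //.
rewrite (eq_normL2 (w := v \- psi)) ?(eq_normL2v (H := fun x => G x - gradient psi x))//.
  by move=> x Ox; rewrite GH.
by move=> x Ox /=; rewrite vw.
Qed.

Lemma Cc_gradient_L2 psi i : Cc_infty Omega psi ->
  L2 Omega (fun x => gradient psi x ord0 i).
Proof.
move=> [spsi _ _].
rewrite (_ : (fun x => _) = iter_derive [:: delta_mx ord0 i] psi).
  exact: (continuous_in_L2 pO (spsi _).1).
by apply/funext => x; rewrite mxE.
Qed.

Lemma Cc_L2 psi : Cc_infty Omega psi -> L2 Omega psi.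
Proof. by move=> [spsi _ _]; exact: (continuous_in_L2 pO (spsi [::]).1). Qed.

Lemma gradient_lin a (psi chi : E -> R) x : Cc_infty Omega psi ->
  Cc_infty Omega chi ->
  gradient (fun y => a * psi y + chi y) x = a *: gradient psi x + gradient chi x.
Proof.
move=> [sp _ _] [sc _ _]; apply/rowP => i; rewrite !mxE.
have /(congr1 (@^~ x)) := iter_derive_lin a sp sc [:: delta_mx ord0 i].
by [].
Qed.

Lemma ip_linl a v w h : L2 Omega v -> L2 Omega w -> L2 Omega h ->
  ip Omega (fun x => a * v x + w x) h = a * ip Omega v h + ip Omega w h.
Proof.
move=> lv lw lh; rewrite /ip -(RintegralZl _ mO (in_L2_mul mO lv lh)).
rewrite -(RintegralD mO (integrableZlr mO a (in_L2_mul mO lv lh))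
  (in_L2_mul mO lw lh)).
by apply: eq_Rintegral => x _; rewrite mulrDl mulrA.
Qed.

(** The weak gradient is only constrained through test functions, so linearity
    needs each pairing to be an honest finite integral: test functions and
    their gradients are square integrable because [Omega] is bounded. *)
Lemma H10_lin a v w G H : H10 Omega v G -> H10 Omega w H ->
  H10 Omega (fun x => a * v x + w x) (fun x => a *: G x + H x).
Proof.
move=> [[lv lG wG] vG] [[lw lH wH] wH0].
have Eg i : (fun x => a * G x ord0 i + H x ord0 i) =
            (fun x => (a *: G x + H x) ord0 i).
  by apply/funext => x; rewrite !mxE.
split.
  split.
  - exact: (L2_lin a lv lw).
  - by move=> i; rewrite -Eg; exact: (L2_lin a (lG i) (lH i)).
  - move=> i psi cpsi.
    rewrite (ip_linl a lv lw (Cc_gradient_L2 i cpsi)) -Eg.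
    rewrite (ip_linl a (lG i) (lH i) (Cc_L2 cpsi)).
    by rewrite (wG i psi cpsi) (wH i psi cpsi) opprD mulrN.
move=> e e0.
have de0 : 0 < e / (4 * (`|a| + 1)) by rewrite divr_gt0// mulr_gt0// ltr_pwDr.
have [psi cp hp] := vG _ de0; have [chi cc hc] := wH0 _ de0.
exists (fun x => a * psi x + chi x); first exact: Cc_infty_lin.
rewrite (eq_normL2 (w := fun x => a * (v x - psi x) + (w x - chi x))); last first.
  by move=> x _ /=; ring.
rewrite (eq_normL2v (H := fun x => a *: (G x - gradient psi x) +
    (H x - gradient chi x))); last first.
  move=> x _; rewrite (gradient_lin a x cp cc) scalerBr opprD addrACA.
  by [].
have lvp : L2 Omega (v \- psi) := L2B lv (Cc_L2 cp).
have lwc : L2 Omega (w \- chi) := L2B lw (Cc_L2 cc).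
have lGp i : L2 Omega (fun x => (G x - gradient psi x) ord0 i).
  apply: (@eq_in_Lp _ _ _ _ _ _ (fun x => G x ord0 i - gradient psi x ord0 i)).
    by move=> x _; rewrite !mxE.
  exact: (L2B (lG i) (Cc_gradient_L2 i cp)).
have lHc i : L2 Omega (fun x => (H x - gradient chi x) ord0 i).
  apply: (@eq_in_Lp _ _ _ _ _ _ (fun x => H x ord0 i - gradient chi x ord0 i)).
    by move=> x _; rewrite !mxE.
  exact: (L2B (lH i) (Cc_gradient_L2 i cc)).
exact: le_lt_trans (lerD (normL2_lin a lvp lwc) (normL2v_lin a lGp lHc))
  (budget_lt e0 hp hc).
Qed.

Lemma H10_0 : H10 Omega (fun=> 0) (fun=> 0).
Proof.
have l0 : L2 Omega (fun=> 0) by exact: in_Lp0.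
have ip0 h : ip Omega (fun=> 0) h = 0.
  rewrite /ip; under eq_Rintegral do rewrite mul0r.
  by rewrite Rintegral_cst// mul0r.
have E0 i : (fun _ : E => (0 : E) ord0 i) = (fun=> 0 : R).
  by apply/funext => x; rewrite mxE.
split.
  split; first exact: l0.
    by move=> i; rewrite E0; exact: l0.
  by move=> i psi _; rewrite E0 !ip0 oppr0.
move=> e e0; exists (fun=> 0); first exact: Cc_infty0.
rewrite (eq_normL2 (w := fun=> 0)); last by move=> x _ /=; rewrite subr0.
rewrite (eq_normL2v (H := fun=> 0)).
  have -> : normL2v Omega (fun=> 0) = 0.
    rewrite /normL2v /ipv (_ : (fun x => _) = fun=> 0).
      by rewrite (Rintegral_cst _ mO) mul0r sqrtr0.
    by apply/funext => x; rewrite /dotv big1// => i _; rewrite mxE mul0r.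
  by rewrite /normL2 ip0 sqrtr0 addr0.
move=> x _; rewrite (_ : gradient _ x = 0) ?subr0//; apply/rowP => i.
by rewrite !mxE; exact: derive_cst.
Qed.

Lemma H10_sum k (c : 'I_k -> R) (v : 'I_k -> E -> R) (G : 'I_k -> E -> E) :
  (forall i, H10 Omega (v i) (G i)) ->
  H10 Omega (fun x => \sum_i c i * v i x) (fun x => \sum_i c i *: G i x).
Proof.
move=> vG; elim: (index_enum _) => [|i s ih].
  by apply: eq_H10 H10_0 => x _; rewrite big_nil.
by apply: eq_H10 (H10_lin (c i) (vG i) ih) => x _; rewrite big_cons.
Qed.

End sobolev.

(** * Conformity of the tensor product space *)

Section time_functions.
Variables (R : realType) (T : R).
Hypothesis T_gt0 : 0 < T.
Local Notation leb := (@lebesgue_measure R).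

Lemma timeI_measurable : measurable (timeI T).
Proof. exact: measurable_itv. Qed.

Lemma timeI_finite : (leb (timeI T) < +oo)%E.
Proof. by rewrite /timeI lebesgue_measure_itv/=; case: ifP => // _; rewrite ltry. Qed.

Lemma timeI_sub : timeI T `<=` `[0, T]%classic.
Proof. by move=> t; rewrite /timeI /= !in_itv/= => /andP[/ltW -> ->]. Qed.

Lemma within_continuous_measurable (phi : R -> R) :
  {within `[0, T]%classic, continuous phi} -> measurable_fun (timeI T) phi.
Proof.
move=> cphi; apply: (@measurable_funS _ _ _ _ `[0, T]%classic) => //.
  exact: timeI_sub.
exact: subspace_continuous_measurable_fun.
Qed.

Lemma within_continuous_bounded (phi : R -> R) :
  {within `[0, T]%classic, continuous phi} ->
  exists2 M, 0 <= M & forall t, timeI T t -> `|phi t| <= M.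
Proof.
move=> cphi.
have /compact_bounded[C [_ CP]] :=
  continuous_compact cphi (@segment_compact _ 0 T).
exists (`|C| + 1) => [|t /timeI_sub It]; first by rewrite addr_ge0.
by apply: (CP (`|C| + 1)); [rewrite ltr_pwDr// ler_norm|exists t].
Qed.

(** The boundary terms vanish because [psi] is supported in the open interval. *)
Lemma parts_Cc (F f psi : R -> R) :
  {within `[0, T]%classic, continuous F} ->
  {within `[0, T]%classic, continuous f} ->
  (forall t, t \in `]0, T[ -> is_derive t 1 F (f t)) ->
  Cc_infty `]0, T[%classic psi ->
  \int[leb]_(t in timeI T) (F t * derive1 psi t) =
  - \int[leb]_(t in timeI T) (f t * psi t).
Proof.
move=> cF cf dF [spsi _ supp].
have cpsi : continuous psi := (spsi [::]).1.
have dpsi x : derivable psi x 1 := (spsi [::]).2 x 1.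
have cdpsi : continuous (derive1 psi).
  rewrite (_ : derive1 psi = iter_derive [:: (1 : R)] psi); first exact: (spsi _).1.
  by apply/funext => t; rewrite derive1E.
have psi0 t : ~ `]0, T[%classic t -> psi t = 0.
  move=> nt; apply/eqP; apply: contra_notT nt => pt; apply: supp.
  exact: subset_closure.
have p0 : psi 0 = 0 by apply: psi0; rewrite /= in_itv/= ltxx.
have pT : psi T = 0 by apply: psi0; rewrite /= in_itv/= ltxx andbF.
have cpsiW : {within `[0, T]%classic, continuous psi} by exact: continuous_subspaceT.
have cdpsiW : {within `[0, T]%classic, continuous (derive1 psi)}.
  exact: continuous_subspaceT.
have Fbnd : derivable_oo_LRcontinuous F 0 T.
  have /continuous_within_itvP-/(_ T_gt0)[_ F0 FT] := cF.
  by split=> // t It; have [] := dF t It.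
have pbnd : derivable_oo_LRcontinuous psi 0 T.
  by have /continuous_within_itvP-/(_ T_gt0)[_ F0 FT] := cpsiW; split.
have Ff : {in `]0, T[, derive1 F =1 f}.
  by move=> t It; rewrite derive1E; have [_ ->] := dF t It.
have := @integration_by_parts R F psi f (derive1 psi) 0 T T_gt0 cf Fbnd Ff
  cdpsiW pbnd (fun _ _ => erefl).
rewrite p0 pT !mulr0 subrr add0e => parts.
rewrite /Rintegral /timeI !integral_itv_obnd_cbnd ?parts ?fineN//.
- apply/measurable_EFinP; apply: measurable_funM.
    exact: within_continuous_measurable.
  exact: within_continuous_measurable.
- apply/measurable_EFinP; apply: measurable_funM.
    exact: within_continuous_measurable.
  exact: within_continuous_measurable.
Qed.

Lemma cvg_sum0 (I : Type) (s : seq I) (X : Type) (F : set_system X) {FF : Filter F}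
    (f : I -> X -> R) :
  (forall i, f i x @[x --> F] --> (0 : R)) ->
  \sum_(i <- s) f i x @[x --> F] --> (0 : R).
Proof.
move=> f0; elim: s => [|i s ih].
  by under eq_fun do rewrite big_nil; exact: cvg_cst.
under eq_fun do rewrite big_cons.
by have := cvgD (f0 i) ih; rewrite addr0; exact.
Qed.

Lemma within_continuous_sum (I : Type) (s : seq I) (A : set R) (f : I -> R -> R) :
  (forall i, {within A, continuous (f i)}) ->
  {within A, continuous (fun t => \sum_(i <- s) f i t)}.
Proof.
move=> cf; elim: s => [|i s ih].
  rewrite (_ : (fun t => _) = cst 0); first by move=> t; exact: cvg_cst.
  by apply/funext => t; rewrite big_nil.
rewrite (_ : (fun t => _) = (fun t => f i t + \sum_(j <- s) f j t)).
  by move=> t; apply: cvgD; [exact: cf|exact: ih].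
by apply/funext => t; rewrite big_cons.
Qed.

Lemma is_derive_sum_seq (I : Type) (s : seq I) (f f' : I -> R -> R) (t : R) :
  (forall i, is_derive t 1 (f i) (f' i t)) ->
  is_derive t 1 (fun t => \sum_(i <- s) f i t) (\sum_(i <- s) f' i t).
Proof.
move=> df; elim: s => [|i s ih].
  rewrite big_nil (_ : (fun t => _) = cst 0); first exact: is_derive_cst.
  by apply/funext => y; rewrite big_nil.
rewrite big_cons (_ : (fun t => _) = f i + (fun t => \sum_(j <- s) f j t)).
  exact: is_deriveD.
by apply/funext => y; rewrite big_cons.
Qed.

End time_functions.

Section discrete_space.
Variables (R : realType) (d : nat) (T : R) (Omega : set 'rV[R]_d).
Hypotheses (T_gt0 : 0 < T) (pO : polyhedral_domain Omega).
Local Notation E := 'rV[R]_d.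
Local Notation leb := (@lebesgue_measure R).
Local Notation lebx := (lebesgue_rV R d).
Let mO : measurable Omega. Proof. exact: polyhedral_measurable. Qed.

Lemma norm_sum_mul_le k (c v : 'I_k -> R) :
  `|\sum_i c i * v i| <= (\sum_i `|c i|) * (\sum_i `|v i|).
Proof.
rewrite mulr_suml; apply: le_trans (ler_norm_sum _ _ _) _.
apply: ler_sum => i _; rewrite normrM ler_wpM2l//.
by rewrite (bigD1 i)//= lerDl sumr_ge0.
Qed.

Lemma cylinder_measurable : measurable (cylinder T Omega).
Proof. by apply: measurableX => //; exact: timeI_measurable. Qed.

Lemma tensor_in_Lp q (phi : R -> R) (v : E -> R) : 0 <= q ->
  {within `[0, T]%classic, continuous phi} -> in_Lp lebx Omega q v ->
  in_Lp_D T Omega q (fun t x => phi t * v x).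
Proof.
move=> q0 cphi lv.
have [M M0 pM] := within_continuous_bounded cphi.
have lv2 := in_Lp_snd (@timeI_measurable R T) mO (timeI_finite T) lv.
have mphi : measurable_fun (cylinder T Omega)
    (fun z : measurableTypeR R * E => phi z.1).
  apply: (measurable_comp (@timeI_measurable R T)).
  - by move=> _ [[t x] [It Ox] <-].
  - exact: within_continuous_measurable.
  - exact: measurable_funTS measurable_fst.
apply: (in_Lp_le cylinder_measurable q0 _ M0 _ lv2).
  exact: (measurable_funM mphi lv2.1).
by move=> [t x] [It Ox] /=; rewrite normrM ler_wpM2r// pM.
Qed.

Lemma tensor_sum_in_Lp q k (phi : 'I_k -> R -> R) (v : 'I_k -> E -> R) g :
  0 < q -> (forall i, {within `[0, T]%classic, continuous (phi i)}) ->
  (forall i, in_Lp lebx Omega q (v i)) ->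
  (forall t x, timeI T t -> Omega x -> g t x = \sum_i phi i t * v i x) ->
  in_Lp_D T Omega q g.
Proof.
move=> q0 cphi lv gE.
apply: (@eq_in_Lp _ _ _ _ _ _
  (fun z : measurableTypeR R * E => \sum_i phi i z.1 * v i z.2)).
  by move=> [t x] [It Ox]; rewrite -gE.
apply: (in_Lp_sum cylinder_measurable _ q0) => i.
exact: (tensor_in_Lp (ltW q0) (cphi i) (lv i)).
Qed.

Lemma tensor_weak_dt k (phi phi' : 'I_k -> R -> R) (v : 'I_k -> E -> R) g g' :
  (forall i, {within `[0, T]%classic, continuous (phi i)}) ->
  (forall i, {within `[0, T]%classic, continuous (phi' i)}) ->
  (forall i t, t \in `]0, T[ -> is_derive t 1 (phi i) (phi' i t)) ->
  (forall t x, timeI T t -> Omega x -> g t x = \sum_i phi i t * v i x) ->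
  (forall t x, timeI T t -> Omega x -> g' t x = \sum_i phi' i t * v i x) ->
  weak_dt T Omega g g'.
Proof.
move=> cphi cphi' dphi gE g'E psi cpsi; apply: aeW => x Ox.
have csum (f : 'I_k -> R -> R) :
    (forall i, {within `[0, T]%classic, continuous (f i)}) ->
    {within `[0, T]%classic, continuous (fun t => \sum_i f i t * v i x)}.
  move=> cf; apply: within_continuous_sum => i t.
  by apply: cvgM; [exact: cf|exact: cvg_cst].
transitivity (\int[leb]_(t in timeI T)
    ((\sum_i phi i t * v i x) * derive1 psi t)).
  by apply: eq_Rintegral => t; rewrite inE => It; rewrite gE.
transitivity (- \int[leb]_(t in timeI T) ((\sum_i phi' i t * v i x) * psi t)); last first.
  by congr (- _); apply: eq_Rintegral => t; rewrite inE => It; rewrite g'E.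
apply: (parts_Cc T_gt0 (csum _ cphi) (csum _ cphi')) => // t It.
apply: (is_derive_sum_seq _ (f' := fun i t => phi' i t * v i x)) => i.
have dp := dphi i t It.
rewrite (_ : (fun t => _) = v i x \*: phi i); last first.
  by apply/funext => y /=; rewrite mulrC.
by rewrite mulrC; exact: is_deriveZ.
Qed.

(** The tensor sum is its own continuous representative: its increments in time
    are dominated by the increments of the coefficients times the fixed square
    integrable function [x |-> \sum_i |v_i x|]. *)
Lemma tensor_zero_at0 k (phi : 'I_k -> R -> R) (v : 'I_k -> E -> R) g :
  (forall i, {within `[0, T]%classic, continuous (phi i)}) ->
  (forall i, phi i 0 = 0) ->
  (forall i, L2 Omega (v i)) ->
  (forall t x, timeI T t -> Omega x -> g t x = \sum_i phi i t * v i x) ->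
  zero_at0 T Omega g.
Proof.
move=> cphi phi0 lv gE.
have lsum (c : 'I_k -> R) : L2 Omega (fun x => \sum_i c i * v i x).
  apply: (in_Lp_sum mO _ (ltr0n _ 2)) => i.
  exact: (in_LpZ mO _ (ler0n _ 2) (lv i)).
have lV : L2 Omega (fun x => \sum_i `|v i x|).
  apply: (in_Lp_sum mO _ (ltr0n _ 2)) => i; exact: in_Lp_norm (lv i).
exists (fun t x => \sum_i phi i t * v i x); split.
- by move=> t _; exact: lsum.
- move=> s Is.
  apply: (@squeeze_cvgr _ _ _ _ (fun=> 0)
    (fun t => (\sum_i `|phi i t - phi i s|) *
              normL2 Omega (fun x => \sum_i `|v i x|))).
  + apply: nearW => t; rewrite normL2_ge0/=.
    rewrite (eq_normL2 (w := fun x => \sum_i (phi i t - phi i s) * v i x)); last first.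
      move=> x _ /=; rewrite -sumrB; apply: eq_bigr => i _; exact/esym/mulrBl.
    apply: (normL2_le pO (lsum _) lV); first exact: sumr_ge0.
    move=> x _; rewrite [X in _ <= _ * X]ger0_norm; last exact: sumr_ge0.
    exact: norm_sum_mul_le.
  + exact: cvg_cst.
  + have h i : `|phi i t - phi i s| @[t --> within `[0, T]%classic (nbhs s)]
        --> (0 : R).
      have /subspace_continuousP/(_ s Is) hs := cphi i.
      have := cvg_norm (cvgB hs (cvg_cst (phi i s))).
      by rewrite subrr normr0; exact.
    have := cvgM (cvg_sum0 (index_enum _) h)
      (cvg_cst (normL2 Omega (fun x => \sum_i `|v i x|))).
    by rewrite mul0r; exact.
- by apply: aeW => t It; apply: aeW => x Ox; rewrite gE.
- by apply: aeW => x _; rewrite big1// => i _; rewrite phi0 mul0r.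
Qed.

(** On each of the finitely many cells [v] is almost everywhere a polynomial, and
    polynomials are bounded on bounded sets. *)
Lemma V_h_bounded s m (K : 'I_m -> set E) v G : is_mesh Omega K ->
  V_h Omega s K v G ->
  exists M, {ae lebx, forall x, Omega x -> `|v x| <= M}.
Proof.
move=> [_ KO _] [_ /(_ _)/cid2-/all_sig2[q qp qE]].
have [B OB] := polyhedral_box pO.
have /choice[M qM] j := poly_fun_bounded B (qp j).
exists (\sum_j `|M j|).
have all_j : {ae lebx, forall x, forall j, (K j `&` Omega) x -> v x = q j x}.
  by apply: filter_forall => j; exact: qE.
apply: filterS all_j => x hx Ox.
have [j _ Kj] : (\bigcup_j K j) x by rewrite KO; exact: subset_closure.
rewrite (hx j)//; apply: le_trans (qM j x (OB x Ox)) _.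
by apply: le_trans (ler_norm _) _; rewrite (bigD1 j)//= lerDl sumr_ge0.
Qed.

(** Makes discrete functions admissible test functions of the continuous problem,
    which is what Galerkin orthogonality rests on. *)
Lemma K_tau_h_sub_K00 p r N tau s m (K : 'I_m -> set E) w : 2 <= p ->
  is_mesh Omega K -> K_tau_h T Omega r N tau s K w -> K00 T Omega p w.
Proof.
move=> p2 mK [k [phi [phi1 [phi2 [v [G [phiU vV wE]]]]]]].
have c0 i : {within `[0, T]%classic, continuous (phi i)}.
  by have [[[]]] := phiU i.
have c1 i : {within `[0, T]%classic, continuous (phi1 i)}.
  by have [[[]]] := phiU i.
have c2 i : {within `[0, T]%classic, continuous (phi2 i)}.
  by have [[[]]] := phiU i.
have d0 i t : t \in `]0, T[ -> is_derive t 1 (phi i) (phi1 i t).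
  by move=> It; have [[[_ _ _ /(_ t It)[]]]] := phiU i.
have d1 i t : t \in `]0, T[ -> is_derive t 1 (phi1 i) (phi2 i t).
  by move=> It; have [[[_ _ _ /(_ t It)[]]]] := phiU i.
have lv i : L2 Omega (v i) by have [[[]]] := vV i.
have lG i j : L2 Omega (fun x => G i x ord0 j).
  have [[[_ lGi _] _] _] := vV i; exact: lGi.
have lvp i : in_Lp lebx Omega p (v i).
  have [M hM] := V_h_bounded mK (vV i).
  exact: (bounded_in_Lp mO p2 (lv i) hM).
have p_gt0 : 0 < p := lt_le_trans (ltr0n _ 2) p2.
have two0 : 0 < 2 :> R := ltr0n _ 2.
have E0 t x : timeI T t -> Omega x -> st_val w t x = \sum_i phi i t * v i x.
  by move=> It Ox; have [] := wE t x It Ox.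
have E1 t x : timeI T t -> Omega x -> st_dt w t x = \sum_i phi1 i t * v i x.
  by move=> It Ox; have [] := wE t x It Ox.
have E2 t x : timeI T t -> Omega x -> st_dtt w t x = \sum_i phi2 i t * v i x.
  by move=> It Ox; have [] := wE t x It Ox.
have E3 t x : timeI T t -> Omega x -> st_grad w t x = \sum_i phi i t *: G i x.
  by move=> It Ox; have [] := wE t x It Ox.
have h0 := tensor_sum_in_Lp two0 c0 lv E0.
split; last 2 first.
- apply: (tensor_zero_at0 c0 _ lv E0) => i; by have [] := phiU i.
- apply: (tensor_zero_at0 c1 _ lv E1) => i; by have [] := phiU i.
split.
- split; first exact: h0.
  + exact: (tensor_sum_in_Lp two0 c1 lv E1).
  + exact: (tensor_sum_in_Lp two0 c2 lv E2).
  + exact: (tensor_weak_dt c0 c1 d0 E0 E1).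
  + exact: (tensor_weak_dt c1 c2 d1 E1 E2).
- split; first exact: h0.
  + move=> j.
    apply: (tensor_sum_in_Lp two0 c0 (fun i => lG i j)) => t x It Ox.
    by rewrite E3// summxE; apply: eq_bigr => i _; rewrite mxE.
  + apply: aeW => t It.
    apply: eq_H10 (H10_sum pO (fun i => phi i t) (fun i => (vV i).1)).
      by move=> x Ox; rewrite E0.
    by move=> x Ox; rewrite E3.
- exact: (tensor_sum_in_Lp p_gt0 c0 lvp E0).
Qed.

End discrete_space.

(** * Scalar steps of the error estimate *)

Section real_arithmetic.
Variable R : realType.

Lemma young2_scaled (C x y : R) : 0 < C ->
  x * y <= C ^+ 2 / 2 * x ^+ 2 + (2 * C ^+ 2)^-1 * (y * y).
Proof.
move=> C0; rewrite -subr_ge0.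
rewrite (_ : _ - _ = (C * x - y / C) ^+ 2 / 2); first by rewrite divr_ge0// sqr_ge0.
by field; rewrite gt_eqF.
Qed.

Lemma apriori_arith (p C A B P F Fi G V L : R) : 0 < C -> 0 <= A ->
  A + p / 2 * B = L -> B = P -> F <= Fi -> G <= A -> V <= C ^+ 2 * G ->
  L <= C ^+ 2 / 2 * F + (2 * C ^+ 2)^-1 * V ->
  p * P <= C ^+ 2 * Fi.
Proof.
move=> C0 A0 eqL BP FF GA VG LY.
have C20 : 0 < C ^+ 2 by rewrite exprn_gt0.
have h1 : (2 * C ^+ 2)^-1 * V <= G / 2.
  have := ler_wpM2l (ltW (_ : 0 < (2 * C ^+ 2)^-1)) VG.
  rewrite invr_gt0 mulr_gt0// => /(_ isT) /le_trans; apply.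
  by rewrite le_eqVlt; apply/orP; left; apply/eqP; field; rewrite gt_eqF.
have h2 : C ^+ 2 / 2 * F <= C ^+ 2 / 2 * Fi by rewrite ler_wpM2l// divr_ge0// ltW.
rewrite -BP; lra.
Qed.

Lemma residual_arith (q a1 a2 b1 b2 : R) : a1 + q * b1 = a2 + q * b2 ->
  a1 - a2 + q * (b1 - b2) = 0.
Proof. by lra. Qed.

Lemma residual_ge_arith (q a1 a2 a3 a4 b1 b2 b3 b4 Aee Aeg Agg m pe c x k1 k2 : R) :
  0 <= q ->
  (a1 - a2) - (a3 - a4) = Aee - Aeg ->
  (b1 - b2) - (b3 - b4) = m - x ->
  c * pe <= m -> x <= c / 2 * pe + k1 + k2 -> Aeg <= Aee / 2 + Agg / 2 ->
  Aee / 2 + q * (c / 2 * pe) - (Agg / 2 + q * (k1 + k2)) <=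
  (a1 - a2 + q * (b1 - b2)) - (a3 - a4 + q * (b3 - b4)).
Proof.
move=> q0 HA HB M P Y.
have h : q * (c / 2 * pe - (k1 + k2)) <= q * ((b1 - b2) - (b3 - b4)).
  by rewrite ler_wpM2l// HB; lra.
lra.
Qed.

Lemma error_arith (p c s sp Ae Pe Ag Pg Pu Ph : R) : 0 < c ->
  2^-1 * Ae + p / 2 * (c / 2 * Pe) -
  (2^-1 * Ag + p / 2 * ((p - 1) * s * (Pu + Ph) +
     (p - 1) ^+ 2 / (c / 2) * sp * Pg)) <= 0 ->
  Ae + p * c / 2 * Pe <= Ag + p * (p - 1) * (Pu + Ph) * s +
  2 * p * (p - 1) ^+ 2 / c * (sp * Pg).
Proof.
move=> c0 h.
have -> : 2 * p * (p - 1) ^+ 2 / c * (sp * Pg) =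
    p * ((p - 1) ^+ 2 / (c / 2) * sp * Pg) by field; rewrite gt_eqF.
lra.
Qed.

(** Taking [s = S^(1/(p-1))] balances the two terms; when [S = 0] one lets [s]
    tend to zero. *)
Lemma balance (p X Y a b S : R) : 2 <= p -> 0 <= a -> 0 <= S ->
  (forall s, 0 < s -> X <= Y + a * s + b * (s `^ (- (p - 2)) * S)) ->
  X <= Y + (a + b) * S `^ (p - 1)^-1.
Proof.
move=> p2 a0; rewrite le_eqVlt => /predU1P[<-|S0] H.
  have p1n : (p - 1)^-1 != 0 by rewrite invr_neq0// gt_eqF//; lra.
  rewrite powR0// mulr0 addr0; apply/ler_addgt0Pr => e e0.
  have := H (e / (a + 1)); rewrite divr_gt0//; last by rewrite ltr_pwDr.
  move=> /(_ isT); rewrite mulr0 mulr0 addr0 => /le_trans; apply.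
  rewrite lerD2l mulrCA ler_piMr ?(ltW e0)// ler_pdivrMr; last by rewrite ltr_pwDr.
  by rewrite mul1r lerDl.
have s0 : 0 < S `^ (p - 1)^-1 by rewrite powR_gt0.
have := H _ s0; rewrite -powRrM.
have -> : S `^ ((p - 1)^-1 * - (p - 2)) * S = S `^ (p - 1)^-1.
  rewrite -[X in _ * X](powRr1 (ltW S0)) -powRD ?(gt_eqF S0) ?implybT//.
  by congr (_ `^ _); field; rewrite gt_eqF//; lra.
by rewrite mulrDl addrA.
Qed.

Lemma apriori_sum (p X Pu Ph : R) : 1 <= p -> p * Pu <= X -> p * Ph <= X ->
  p * (p - 1) * (Pu + Ph) <= (p - 1) * (2 * X).
Proof.
move=> p1 hu hh; rewrite [p * _]mulrC -mulrA ler_wpM2l ?subr_ge0//.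
by rewrite mulrDr mulr_natl mulr2n lerD.
Qed.

(** The exponents are those in which [normLpeps_powR] delivers the powers of the
    norm. *)
Lemma final_arith (p al a a' b Ae We Ag Wg x y z t w : R) : 2 <= p -> 0 <= a ->
  a' <= a -> 0 <= We -> 0 <= Wg ->
  (forall s, 0 < s ->
     Ae + al * We <= Ag + a' * s + b * (s `^ (- (p - 2)) * Wg)) ->
  x = Ae -> y = We `^ (p / p) ->
  z = Ag -> t = Wg `^ (p / (p - 1) / p) -> w = Wg `^ (p / p) ->
  x + al * y <= z + (a + b) * t + 1 * w.
Proof.
move=> p2 a0 a'a We0 Wg0 H -> -> -> -> ->.
have p_gt0 : 0 < p by lra.
have p1_gt0 : 0 < p - 1 by lra.
have -> : p / (p - 1) / p = (p - 1)^-1 by field; rewrite !gt_eqF.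
rewrite divff ?gt_eqF// !powRr1// mul1r.
apply: (@le_trans _ _ (Ag + (a + b) * Wg `^ (p - 1)^-1)); last by rewrite lerDl.
apply: balance => // s s0; apply: le_trans (H s s0) _.
by rewrite lerD2r lerD2l ler_wpM2r// ltW.
Qed.

End real_arithmetic.

(** * The weighted forms as integrals over the cylinder *)

Section weighted_forms.
Variables (R : realType) (d : nat) (T : R) (Omega : set 'rV[R]_d) (p eps : R).
Hypotheses (pO : polyhedral_domain Omega) (p_ge2 : 2 <= p)
  (eps_gt0 : 0 < eps).
Local Notation E := 'rV[R]_d.
Local Notation leb := (@lebesgue_measure R).
Local Notation lebx := (lebesgue_rV R d).
Local Notation lebtx := (leb \x lebx)%E.
Local Notation cyl := (cylinder T Omega).
Local Notation TE := (measurableTypeR R * E)%type.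
Implicit Types (h k : TE -> R) (u v w e : stfun R d).
Let mO : measurable Omega. Proof. exact: polyhedral_measurable. Qed.
Let mC : measurable cyl. Proof. exact: cylinder_measurable. Qed.
Let mI : measurable (timeI T). Proof. exact: timeI_measurable. Qed.
Let p_gt0 : 0 < p. Proof. exact: lt_le_trans p_ge2. Qed.
Let two0 : 0 <= 2 :> R. Proof. exact: ler0n. Qed.

Definition weight (t : R) : R := expR (- t / eps).

Lemma weight_le1 t : timeI T t -> weight t <= 1.
Proof.
rewrite /timeI /= in_itv/= => /andP[t0 _].
by rewrite /weight -expR0 ler_expR mulNr oppr_le0 divr_ge0// ltW.
Qed.

Lemma measurable_weight D : measurable_fun D (weight : measurableTypeR R -> R).
Proof.
apply: measurable_funTS; apply: continuous_measurable_fun => t.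
apply: continuous_comp; last exact: continuous_expR.
by apply: cvgM; [apply: cvgN; exact: cvg_id|exact: cvg_cst].
Qed.

Definition cyl_integrable h := lebtx.-integrable cyl (EFin \o h).

Definition weighted_int h : R := \int[lebtx]_(z in cyl) (weight z.1 * h z).

Lemma weighted_integrable h :
  cyl_integrable h -> cyl_integrable (fun z => weight z.1 * h z).
Proof.
move=> ih; apply: (le_Rintegrable mC _ _ (integrable_norm ih)).
  apply: measurable_funM; last by apply/measurable_EFinP; exact: (measurable_int _ ih).
  apply: (measurable_comp mI).
  - by move=> _ [[t x] [It Ox] <-].
  - exact: measurable_weight.
  - exact: measurable_funTS measurable_fst.
move=> [t x] [It Ox] /=; rewrite normrM ger0_norm ?expR_ge0//.
by rewrite ler_piMl// weight_le1.
Qed.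

(** Moving the weight inside the inner integral is legitimate at almost every
    time only, since sections of an integrable function may fail to be
    integrable on a null set. *)
Lemma wint_fubini h : cyl_integrable h ->
  leb.-integrable (timeI T)
    (EFin \o (fun t => weight t * \int[lebx]_(x in Omega) h (t, x))) /\
  wint T eps (fun t => \int[lebx]_(x in Omega) h (t, x)) = weighted_int h.
Proof.
move=> ih.
have [ae1 i1 _] := Rfubini mI mO ih.
have [_ i2 e2] := Rfubini mI mO (weighted_integrable ih).
have m1 : measurable_fun (timeI T)
    (fun t => weight t * \int[lebx]_(x in Omega) h (t, x)).
  apply: measurable_funM; first exact: measurable_weight.
  by apply/measurable_EFinP; exact: (measurable_int _ i1).
have m2 : measurable_fun (timeI T)
    (fun t => \int[lebx]_(x in Omega) (weight t * h (t, x))).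
  by apply/measurable_EFinP; exact: (measurable_int _ i2).
have E12 : {ae leb, forall t, timeI T t ->
    weight t * \int[lebx]_(x in Omega) h (t, x) =
    \int[lebx]_(x in Omega) (weight t * h (t, x))}.
  apply: filterS ae1 => t ht It.
  exact/esym/(RintegralZl _ mO (ht It)).
split.
  apply: (ae_eq_integrable mI _ _ _ i2).
  - exact/measurable_EFinP.
  - exact/measurable_EFinP.
  - by apply: filterS E12 => t ht It /=; rewrite ht.
rewrite /weighted_int -e2 /wint.
exact: (ae_eq_Rintegral mI m1 m2 E12).
Qed.

Lemma weighted_int_ge0 h : (forall z, cyl z -> 0 <= h z) -> 0 <= weighted_int h.
Proof.
by move=> h0; apply: Rintegral_ge0 => z Cz; rewrite mulr_ge0 ?expR_ge0// h0.
Qed.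

Lemma weighted_int_le h k : cyl_integrable h -> cyl_integrable k ->
  (forall z, cyl z -> h z <= k z) -> weighted_int h <= weighted_int k.
Proof.
move=> ih ik hk.
apply: (le_Rintegral mC (weighted_integrable ih) (weighted_integrable ik)).
by move=> z Cz; rewrite ler_wpM2l ?expR_ge0// hk.
Qed.

Lemma weighted_intD h k : cyl_integrable h -> cyl_integrable k ->
  weighted_int (fun z => h z + k z) = weighted_int h + weighted_int k.
Proof.
move=> ih ik; rewrite /weighted_int.
rewrite -(RintegralD mC (weighted_integrable ih) (weighted_integrable ik)).
by apply: eq_Rintegral => z _; rewrite mulrDr.
Qed.

Lemma weighted_intB h k : cyl_integrable h -> cyl_integrable k ->
  weighted_int (fun z => h z - k z) = weighted_int h - weighted_int k.
Proof.
move=> ih ik; rewrite /weighted_int.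
rewrite -(RintegralB mC (weighted_integrable ih) (weighted_integrable ik)).
by apply: eq_Rintegral => z _; rewrite mulrBr.
Qed.

Lemma weighted_intZ c h : cyl_integrable h ->
  weighted_int (fun z => c * h z) = c * weighted_int h.
Proof.
move=> ih; rewrite /weighted_int -(RintegralZl c mC (weighted_integrable ih)).
by apply: eq_Rintegral => z _; rewrite mulrCA.
Qed.

(** What the forms require for their integrands to be integrable; unlike the
    admissible class it is stable under differences by a pointwise argument. *)
Definition finite_energy u : Prop :=
  [/\ in_Lp_D T Omega 2 (st_val u), in_Lp_D T Omega 2 (st_dtt u),
      forall i : 'I_d, in_Lp_D T Omega 2 (fun t x => st_grad u t x ord0 i) &
      in_Lp_D T Omega p (st_val u)].

Lemma K00_finite_energy u : K00 T Omega p u -> finite_energy u.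
Proof. by move=> [[[l0 l1 l2 _ _] [_ lG _] lp] _ _]; split. Qed.

Lemma finite_energy_sub u v : finite_energy u -> finite_energy v ->
  finite_energy (st_sub u v).
Proof.
move=> [u0 u2 uG up] [v0 v2 vG vp]; split.
- exact: (in_LpB mC two0 u0 v0).
- exact: (in_LpB mC two0 u2 v2).
- move=> i; apply: eq_in_Lp (in_LpB mC two0 (uG i) (vG i)) => z _.
  by rewrite /= !mxE.
- exact: (in_LpB mC (ltW p_gt0) up vp).
Qed.

Definition val_at u (z : TE) : R := st_val u z.1 z.2.
Definition dtt_at u (z : TE) : R := st_dtt u z.1 z.2.
Definition grad_at u (z : TE) : E := st_grad u z.1 z.2.

Definition densA u v (z : TE) : R :=
  eps ^+ 2 * (dtt_at u z * dtt_at v z) + dotv (grad_at u z) (grad_at v z).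
Definition densB u v (z : TE) : R := spow p (val_at u z) * val_at v z.
Definition densp u (z : TE) : R := `|val_at u z| `^ p.

Lemma dtt_integrable u v : finite_energy u -> finite_energy v ->
  cyl_integrable (fun z => eps ^+ 2 * (dtt_at u z * dtt_at v z)).
Proof.
move=> [_ u2 _ _] [_ v2 _ _].
exact: (integrableZlr mC (eps ^+ 2) (in_L2_mul mC u2 v2)).
Qed.

Lemma grad_integrable u v : finite_energy u -> finite_energy v ->
  cyl_integrable (fun z => dotv (grad_at u z) (grad_at v z)).
Proof. by move=> [_ _ uG _] [_ _ vG _]; exact: (in_L2_dotv mC uG vG). Qed.

Lemma densA_integrable u v : finite_energy u -> finite_energy v ->
  cyl_integrable (densA u v).
Proof.
by move=> fu fv; exact: (integrableDr mC (dtt_integrable fu fv) (grad_integrable fu fv)).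
Qed.

Lemma densB_integrable u v : finite_energy u -> finite_energy v ->
  cyl_integrable (densB u v).
Proof.
by move=> [_ _ _ up] [_ _ _ vp]; exact: (in_Lp_spow_mul mC p_ge2 up vp).
Qed.

Lemma densp_integrable u : finite_energy u -> cyl_integrable (densp u).
Proof. by move=> [_ _ _ up]; exact: (in_Lp_integrable up). Qed.

Lemma bilinAE u v : finite_energy u -> finite_energy v ->
  bilinA T Omega eps u v = weighted_int (densA u v).
Proof.
move=> fu fv.
have [_ u2 _ _] := fu; have [_ v2 _ _] := fv.
have [i1 e1] := wint_fubini (in_L2_mul mC u2 v2).
have [i2 e2] := wint_fubini (grad_integrable fu fv).
rewrite /densA weighted_intD; [|exact: dtt_integrable|exact: grad_integrable].
rewrite (weighted_intZ (eps ^+ 2) (in_L2_mul mC u2 v2)) -e1 -e2.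
rewrite /wint -(RintegralZl _ mI i1).
rewrite -(RintegralD mI (integrableZlr mI _ i1) i2) /bilinA /wint.
by apply: eq_Rintegral => t _; rewrite mulrDr mulrCA.
Qed.

Lemma semilinBE u v : finite_energy u -> finite_energy v ->
  semilinB T Omega eps p u v = p / 2 * weighted_int (densB u v).
Proof.
move=> fu fv; have [_ e1] := wint_fubini (densB_integrable fu fv).
by rewrite -e1.
Qed.

Lemma loadFE f v : in_Lp_D T Omega 2 f -> finite_energy v ->
  loadF T Omega eps f v = weighted_int (fun z => f z.1 z.2 * val_at v z).
Proof.
move=> lf [v0 _ _ _]; have [_ e1] := wint_fubini (in_L2_mul mC lf v0).
by rewrite -e1.
Qed.

Lemma densA_ge0 u : 0 <= weighted_int (densA u u).
Proof.
by apply: weighted_int_ge0 => z _; rewrite addr_ge0 ?dotv_ge0// mulr_ge0 ?sqr_ge0.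
Qed.

Lemma normE_sqr u : finite_energy u ->
  normE T Omega eps u ^+ 2 = weighted_int (densA u u).
Proof.
move=> fu; rewrite /normE bilinAE// sqr_sqrtr//; exact: densA_ge0.
Qed.

Lemma normLpeps_powR u q : finite_energy u ->
  normLpeps T Omega eps p u `^ q = weighted_int (densp u) `^ (q / p).
Proof.
move=> fu; have [_ e1] := wint_fubini (densp_integrable fu).
rewrite /normLpeps -powRrM mulrC; congr (_ `^ _); rewrite -e1.
congr wint; apply/funext => t; rewrite /normLp -powRrM mulVf ?gt_eqF//.
by rewrite powRr1//; apply: Rintegral_ge0 => x _; exact: powR_ge0.
Qed.

Lemma densp_ge0 u : 0 <= weighted_int (densp u).
Proof. by apply: weighted_int_ge0 => z _; exact: powR_ge0. Qed.

(** Testing the equation with its own solution: the Poincare inequality absorbs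
    the load into the energy, uniformly in [eps] since the weight is at most
    [1]. *)
Lemma apriori_bound C f u : poincare_constant Omega C ->
  in_Lp_D T Omega 2 f -> K00 T Omega p u ->
  bilinA T Omega eps u u + semilinB T Omega eps p u u = loadF T Omega eps f u ->
  p * weighted_int (densp u) <= C ^+ 2 * \int[lebtx]_(z in cyl) (f z.1 z.2 ^+ 2).
Proof.
move=> [C0 poin] lf Ku.
have fu := K00_finite_energy Ku.
have [u0 u2 uG up] := fu.
rewrite (bilinAE fu fu) (semilinBE fu fu) (loadFE lf fu) => eq0.
have if2 : cyl_integrable (fun z => f z.1 z.2 ^+ 2) := in_L2_sqr mC lf.
have iu2 : cyl_integrable (fun z => val_at u z * val_at u z) := in_L2_mul mC u0 u0.
have iG := grad_integrable fu fu.
have BE : weighted_int (densB u u) = weighted_int (densp u).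
  by congr weighted_int; apply/funext => z; rewrite /densB spowM.
have Fle : weighted_int (fun z => f z.1 z.2 ^+ 2) <=
    \int[lebtx]_(z in cyl) (f z.1 z.2 ^+ 2).
  apply: (le_Rintegral mC (weighted_integrable if2) if2) => -[t x] [It Ox] /=.
  by rewrite ler_piMl ?sqr_ge0// weight_le1.
have Gle : weighted_int (fun z => dotv (grad_at u z) (grad_at u z)) <=
    weighted_int (densA u u).
  apply: (weighted_int_le iG (densA_integrable fu fu)) => z _.
  by rewrite /densA lerDr mulr_ge0 ?sqr_ge0// -expr2 sqr_ge0.
have Ple : weighted_int (fun z => val_at u z * val_at u z) <=
    C ^+ 2 * weighted_int (fun z => dotv (grad_at u z) (grad_at u z)).
  have [i1 e1] := wint_fubini iu2; have [i2 e2] := wint_fubini iG.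
  rewrite -e1 -e2 /wint -(RintegralZl _ mI i2).
  apply: (ae_le_Rintegral mI i1 (integrableZlr mI _ i2)).
  have [[_ [_ _ aeH] _] _ _] := Ku.
  apply: filterS aeH => t ht It.
  have vG := poin _ _ (ht It).
  have vG0 : 0 <= C * normL2v Omega (st_grad u t).
    by rewrite mulr_ge0 ?normL2v_ge0// ltW.
  have : normL2 Omega (st_val u t) ^+ 2 <= (C * normL2v Omega (st_grad u t)) ^+ 2.
    by rewrite lerXn2r ?nnegrE ?normL2_ge0.
  rewrite exprMn normL2_sqr normL2v_sqr => vG2.
  by rewrite mulrCA; apply: ler_wpM2l vG2; exact: expR_ge0.
have Yle : weighted_int (fun z => f z.1 z.2 * val_at u z) <=
    C ^+ 2 / 2 * weighted_int (fun z => f z.1 z.2 ^+ 2) +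
    (2 * C ^+ 2)^-1 * weighted_int (fun z => val_at u z * val_at u z).
  have j1 := integrableZlr mC (C ^+ 2 / 2) if2.
  have j2 := integrableZlr mC (2 * C ^+ 2)^-1 iu2.
  rewrite -(weighted_intZ _ if2) -(weighted_intZ _ iu2) -(weighted_intD j1 j2).
  apply: (weighted_int_le (in_L2_mul mC lf u0) (integrableDr mC j1 j2)) => z _.
  exact: young2_scaled.
exact: (apriori_arith C0 (densA_ge0 u) eq0 BE Fle Gle Ple Yle).
Qed.

(** Its weighted integral is the difference of the two weak forms tested with
    [w]; it vanishes when both equations can be tested with [w]. *)
Definition residual u uh w (z : TE) : R :=
  (densA u w z - densA uh w z) + p / 2 * (densB u w z - densB uh w z).

Lemma residual_integrable u uh w :
  finite_energy u -> finite_energy uh -> finite_energy w ->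
  cyl_integrable (residual u uh w).
Proof.
move=> fu fh fw.
apply: (integrableDr mC (integrableBr mC (densA_integrable fu fw)
  (densA_integrable fh fw))).
exact: (integrableZlr mC _ (integrableBr mC (densB_integrable fu fw)
  (densB_integrable fh fw))).
Qed.

Lemma residual0 u uh w :
  finite_energy u -> finite_energy uh -> finite_energy w ->
  bilinA T Omega eps u w + semilinB T Omega eps p u w =
  bilinA T Omega eps uh w + semilinB T Omega eps p uh w ->
  weighted_int (residual u uh w) = 0.
Proof.
move=> fu fh fw.
rewrite (bilinAE fu fw) (semilinBE fu fw) (bilinAE fh fw) (semilinBE fh fw).
have a1 := densA_integrable fu fw; have a2 := densA_integrable fh fw.
have b1 := densB_integrable fu fw; have b2 := densB_integrable fh fw.
rewrite /residual (weighted_intD (integrableBr mC a1 a2)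
  (integrableZlr mC _ (integrableBr mC b1 b2))).
rewrite (weighted_intZ _ (integrableBr mC b1 b2)).
rewrite (weighted_intB a1 a2) (weighted_intB b1 b2).
exact: residual_arith.
Qed.

Lemma densA_young e g z : densA e g z <= densA e e z / 2 + densA g g z / 2.
Proof.
rewrite /densA /dotv.
set De := dtt_at e z; set Dg := dtt_at g z.
have h1 : eps ^+ 2 * (De * Dg) <= eps ^+ 2 * (De * De) / 2 + eps ^+ 2 * (Dg * Dg) / 2.
  have := mulr_ge0 (sqr_ge0 eps) (sqr_ge0 (De - Dg)).
  move: (eps ^+ 2) => q; nra.
have h2 : \sum_i grad_at e z ord0 i * grad_at g z ord0 i <=
    (\sum_i grad_at e z ord0 i * grad_at e z ord0 i) / 2 +
    (\sum_i grad_at g z ord0 i * grad_at g z ord0 i) / 2.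
  rewrite !mulr_suml -big_split/=; apply: ler_sum => i _.
  by have := sqr_ge0 (grad_at e z ord0 i - grad_at g z ord0 i); lra.
move: h1 h2; move: (\sum_i _) (\sum_i _) (\sum_i _) => S1 S2 S3; lra.
Qed.

(** The residual is affine in the test function, so the right-hand side is the
    residual tested with [v - uh = e - g]; monotonicity handles the part in [e],
    Young's inequalities the part in [g]. *)
Lemma residual_ge u uh v s z (c := 2 `^ (1 - p))
    (e := st_sub u uh) (g := st_sub u v) : 0 < s ->
  densA e e z / 2 + p / 2 * (c / 2 * densp e z) -
  (densA g g z / 2 + p / 2 * ((p - 1) * s * (densp u z + densp uh z) +
     (p - 1) ^+ 2 / (c / 2) * s `^ (- (p - 2)) * densp g z)) <=
  residual u uh v z - residual u uh uh z.
Proof.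
move=> s0.
have c0 : 0 < c by rewrite powR_gt0.
have c20 : 0 < c / 2 by rewrite divr_gt0.
have HA : (densA u v z - densA uh v z) - (densA u uh z - densA uh uh z) =
    densA e e z - densA e g z.
  have hd : dotv (grad_at u z) (grad_at v z) - dotv (grad_at uh z) (grad_at v z) -
    (dotv (grad_at u z) (grad_at uh z) - dotv (grad_at uh z) (grad_at uh z)) +
    dotv (grad_at e z) (grad_at g z) = dotv (grad_at e z) (grad_at e z).
    rewrite /dotv -!sumrB -big_split/=; apply: eq_bigr => i _.
    by rewrite /e /g /grad_at /= !mxE; ring.
  have dE : dtt_at e z = dtt_at u z - dtt_at uh z by [].
  have dG : dtt_at g z = dtt_at u z - dtt_at v z by [].
  by rewrite /densA -hd dE dG; ring.
have HB : (densB u v z - densB uh v z) - (densB u uh z - densB uh uh z) =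
    (spow p (val_at u z) - spow p (val_at uh z)) * (val_at u z - val_at uh z) -
    (spow p (val_at u z) - spow p (val_at uh z)) * (val_at u z - val_at v z).
  by rewrite /densB; ring.
have eE : densp e z = `|val_at u z - val_at uh z| `^ p by [].
have gE : densp g z = `|val_at u z - val_at v z| `^ p by [].
have M := spow_mono p_ge2 (val_at u z) (val_at uh z).
have P := spow_perturb p_ge2 (val_at u z) (val_at uh z) (val_at u z - val_at v z)
  c20 s0.
rewrite -eE -gE -/c in M P.
have Y := densA_young e g z.
have p20 : 0 <= p / 2 by rewrite divr_ge0// ltW.
rewrite /residual.
exact: (residual_ge_arith p20 HA HB M P Y).
Qed.

Lemma error_bound u uh v s (c := 2 `^ (1 - p))
    (e := st_sub u uh) (g := st_sub u v) : finite_energy u -> finite_energy uh ->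
  finite_energy v -> 0 < s ->
  weighted_int (residual u uh v) = 0 -> weighted_int (residual u uh uh) = 0 ->
  weighted_int (densA e e) + p * c / 2 * weighted_int (densp e) <=
  weighted_int (densA g g) +
  p * (p - 1) * (weighted_int (densp u) + weighted_int (densp uh)) * s +
  2 * p * (p - 1) ^+ 2 / c * (s `^ (- (p - 2)) * weighted_int (densp g)).
Proof.
move=> fu fh fv s0 rv rh.
have c0 : 0 < c by rewrite powR_gt0.
have fe : finite_energy e := finite_energy_sub fu fh.
have fg : finite_energy g := finite_energy_sub fu fv.
have ae := densA_integrable fe fe; have ag := densA_integrable fg fg.
have pe := densp_integrable fe; have pg := densp_integrable fg.
have pu := densp_integrable fu; have ph := densp_integrable fh.
pose K1 := (p - 1) * s; pose K2 := (p - 1) ^+ 2 / (c / 2) * s `^ (- (p - 2)).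
have i1 : cyl_integrable (fun z => densA e e z / 2 + p / 2 * (c / 2 * densp e z)).
  have := integrableDr mC (integrableZlr mC 2^-1 ae)
    (integrableZlr mC (p / 2) (integrableZlr mC (c / 2) pe)).
  by apply: eq_integrable => // z _ /=; rewrite mulrC.
have i3 := integrableDr mC (integrableZlr mC K1 (integrableDr mC pu ph))
  (integrableZlr mC K2 pg).
have i2 : cyl_integrable (fun z => densA g g z / 2 +
    p / 2 * (K1 * (densp u z + densp uh z) + K2 * densp g z)).
  have := integrableDr mC (integrableZlr mC 2^-1 ag) (integrableZlr mC (p / 2) i3).
  by apply: eq_integrable => // z _ /=; rewrite mulrC.
have ir := integrableBr mC (residual_integrable fu fh fv)
  (residual_integrable fu fh fh).
have := weighted_int_le (integrableBr mC i1 i2) ir (fun z _ => residual_ge u uh v z s0).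
rewrite (weighted_intB (residual_integrable fu fh fv) (residual_integrable fu fh fh)).
rewrite rv rh.
rewrite (weighted_intB i1 i2).
have -> : weighted_int (fun z => densA e e z / 2 + p / 2 * (c / 2 * densp e z)) =
    2^-1 * weighted_int (densA e e) + p / 2 * (c / 2 * weighted_int (densp e)).
  rewrite -(weighted_intZ (c / 2) pe)
    -(weighted_intZ (p / 2) (integrableZlr mC (c / 2) pe)) -(weighted_intZ 2^-1 ae).
  rewrite -(weighted_intD (integrableZlr mC 2^-1 ae)
    (integrableZlr mC (p / 2) (integrableZlr mC (c / 2) pe))).
  by congr weighted_int; apply/funext => z; rewrite [X in X + _]mulrC.
have -> : weighted_int (fun z => densA g g z / 2 +
    p / 2 * (K1 * (densp u z + densp uh z) + K2 * densp g z)) =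
    2^-1 * weighted_int (densA g g) +
    p / 2 * (K1 * (weighted_int (densp u) + weighted_int (densp uh)) +
             K2 * weighted_int (densp g)).
  rewrite -(weighted_intD pu ph)
    -(weighted_intZ K1 (integrableDr mC pu ph)) -(weighted_intZ K2 pg).
  rewrite -(weighted_intD (integrableZlr mC K1 (integrableDr mC pu ph))
    (integrableZlr mC K2 pg)).
  rewrite -(weighted_intZ (p / 2) i3) -(weighted_intZ 2^-1 ag).
  rewrite -(weighted_intD (integrableZlr mC 2^-1 ag) (integrableZlr mC (p / 2) i3)).
  by congr weighted_int; apply/funext => z; rewrite [X in X + _]mulrC.
rewrite subrr; exact: error_arith.
Qed.

End weighted_forms.

(** * The quasi-best approximation estimate *)

(** Since [f] vanishes outside the cylinder, the constant of the a priori bound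
    depends on [f] alone and not on [Omega]. *)
Lemma cylinder_sqr_integral (R : realType) (d : nat) (T : R)
    (Omega : set 'rV[R]_d) (f : R -> 'rV[R]_d -> R) :
  (forall t x, ~ (timeI T t /\ Omega x) -> f t x = 0) ->
  \int[(@lebesgue_measure R \x lebesgue_rV R d)%E]_(z in cylinder T Omega)
    (f z.1 z.2 ^+ 2) =
  \int[(@lebesgue_measure R \x lebesgue_rV R d)%E]_(z in cylinder T setT)
    (f z.1 z.2 ^+ 2).
Proof.
move=> f0; rewrite Rintegral_mkcond [RHS]Rintegral_mkcond; apply: eq_Rintegral.
move=> [t x] _; rewrite !patchE.
have [Otx|Otx] := pselect (cylinder T Omega (t, x)).
  by rewrite !mem_set//; case: Otx.
rewrite memNset//= f0// expr0n/=.
by case: (_ \in _).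
Qed.

Theorem theorem4p1 (R : realType) (p : R) (p_ge2 : 2 <= p) :
  exists alpha gamma : R, 0 < alpha /\ 0 < gamma /\
  forall (d : nat) (C T : R) (f : R -> 'rV[R]_d -> R),
    (1 <= d <= 3)%N -> 0 < T ->
  exists beta : R, 0 < beta /\
  forall Omega : set 'rV[R]_d,
    polyhedral_domain Omega ->
    poincare_constant Omega C ->
    in_Lp_D T Omega 2 f ->
    (forall t x, ~ (timeI T t /\ Omega x) -> f t x = 0) ->
  forall (r N : nat) (tau : nat -> R) (s m : nat) (K : 'I_m -> set 'rV[R]_d)
         (sigma : R),
    (1 <= r)%N -> (1 <= s)%N ->
    time_partition T N tau ->
    is_mesh Omega K -> shape_regular sigma K ->
  forall (eps : R) (u uh : stfun R d),
    0 < eps ->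
    K00 T Omega p u ->
    (forall v, K00 T Omega p v ->
       bilinA T Omega eps u v + semilinB T Omega eps p u v
       = loadF T Omega eps f v) ->
    K_tau_h T Omega r N tau s K uh ->
    (forall v, K_tau_h T Omega r N tau s K v ->
       bilinA T Omega eps uh v + semilinB T Omega eps p uh v
       = loadF T Omega eps f v) ->
  normE T Omega eps (st_sub u uh) ^+ 2
    + alpha * normLpeps T Omega eps p (st_sub u uh) `^ p
  <= inf [set normE T Omega eps (st_sub u v) ^+ 2
              + beta * normLpeps T Omega eps p (st_sub u v) `^ (p / (p - 1))
              + gamma * normLpeps T Omega eps p (st_sub u v) `^ p
         | v in K_tau_h T Omega r N tau s K].
Proof.
have hp := p_ge2.
have p_gt0 : 0 < p by lra.
have p_ge1 : 1 <= p by lra.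
have p1_gt0 : 0 < p - 1 by lra.
pose c : R := 2 `^ (1 - p).
have c0 : 0 < c by rewrite powR_gt0.
exists (p * c / 2), 1; split; first by rewrite divr_gt0// mulr_gt0.
split=> // d C T f _ T_gt0.
pose F := \int[(@lebesgue_measure R \x lebesgue_rV R d)%E]_(z in cylinder T setT)
  (f z.1 z.2 ^+ 2).
have F0 : 0 <= F by apply: Rintegral_ge0 => z _; rewrite sqr_ge0.
(* [a] bounds the factor of [s] in [error_bound] by the a priori estimates of
   [u] and [uh]; [b] is the factor of [s^(-(p-2))]. *)
pose a := (p - 1) * (2 * (C ^+ 2 * F)).
pose b := 2 * p * (p - 1) ^+ 2 / c.
have a0 : 0 <= a :=
  mulr_ge0 (ltW p1_gt0) (mulr_ge0 (ler0n _ 2) (mulr_ge0 (sqr_ge0 C) F0)).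
have b0 : 0 < b by rewrite /b divr_gt0// mulr_gt0 ?exprn_gt0// mulr_gt0.
exists (a + b); split; first by rewrite ltr_wpDl.
move=> Omega pO poin lf f0 r N tau s m K sigma _ _ _ mK _ eps u uh eps0 Ku eqU Kh eqH.
have sub w : K_tau_h T Omega r N tau s K w -> K00 T Omega p w.
  exact: (K_tau_h_sub_K00 T_gt0 pO p_ge2 mK).
have fu := K00_finite_energy Ku; have fh := K00_finite_energy (sub _ Kh).
have Pu := apriori_bound pO p_ge2 eps0 poin lf Ku (eqU _ Ku).
have Ph := apriori_bound pO p_ge2 eps0 poin lf (sub _ Kh) (eqH _ Kh).
rewrite (cylinder_sqr_integral f0) -/F in Pu Ph.
have orth w : K_tau_h T Omega r N tau s K w ->
    weighted_int T Omega eps (residual p eps u uh w) = 0.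
  move=> Kw; apply: (residual0 pO p_ge2 eps0 fu fh (K00_finite_energy (sub _ Kw))).
  exact: etrans (eqU _ (sub _ Kw)) (esym (eqH _ Kw)).
apply: lb_le_inf; first by eexists; exists uh.
move=> _ [v Kv <-].
have fv := K00_finite_energy (sub _ Kv).
have fe := finite_energy_sub pO p_ge2 fu fh.
have fg := finite_energy_sub pO p_ge2 fu fv.
apply: (final_arith p_ge2 a0 (apriori_sum p_ge1 Pu Ph)
  (densp_ge0 T Omega p eps _) (densp_ge0 T Omega p eps _) _
  (normE_sqr pO eps0 fe) (normLpeps_powR pO p_ge2 eps0 _ fe)
  (normE_sqr pO eps0 fg) (normLpeps_powR pO p_ge2 eps0 _ fg)
  (normLpeps_powR pO p_ge2 eps0 _ fg)) => l l0.
exact: (error_bound pO p_ge2 eps0 fu fh fv l0 (orth _ Kv) (orth _ Kh)).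
Qed.
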